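(* Let $\mathbb K$ be a field, $R=\mathbb K[x_0,\dots,x_n]$, and let $J\subset R$ be an Artinian monomial ideal. (i) An ideal $I\subset R$ generated by a $\mathcal P_J$-marked basis $\mathcal H$ is Gorenstein if and only if the coefficient matrix of the homogeneous linear system $\Sigma_{\mathcal H}$ has rank $r-1$, where $r$ is the number of polynomials in $\mathcal H$ whose head term is divisible by $x_0$. (ii) The Gorenstein locus in the marked scheme $\mathbf{Mf}_J$, i.e. the set of points of $\mathbf{Mf}_J$ corresponding to Gorenstein ideals, is an open subset of $\mathbf{Mf}_J$.
   Context: $R=\mathbb K[x_0,\dots,x_n]$ has the standard grading and variables ordered $x_0<\dots<x_n$. A term is a monomial $x^\alpha$; for $x^\alpha\neq 1$, $\min(x^\alpha)$ (resp. $\max(x^\alpha)$) is the smallest (resp. largest) variable dividing it; $x_i$ is multiplicative for $x^\alpha$ if $x_i\le\min(x^\alpha)$, else non-multiplicative. Every Artinian monomial ideal $J$ has a (unique) Pommaret basis $\mathcal P_J$: a finite set of terms generating $J$ such that for every term $x^\tau\in J\setminus\mathcal P_J$ there is a unique $x^\sigma\in\mathcal P_J$ with $x^\tau=x^\delta x^\sigma$ and $\max(x^\delta)\le\min(x^\sigma)$. $\mathcal N(J)$ is the set of terms not in $J$; $\mathcal N(J)_t$ those of degree $t$. For a Noetherian $\mathbb K$-algebra $A$ put $R_A=A[x_0,\dots,x_n]$. A $\mathcal P_J$-marked set in $R_A$ is a set $\mathcal H=\{h_\alpha\}_{x^\alpha\in\mathcal P_J}$ of homogeneous polynomials such that $x^\alpha$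 (the head term) occurs in $h_\alpha$ with coefficient $1$ and all other terms occurring in $h_\alpha$ lie in $\mathcal N(J)$. It is a $\mathcal P_J$-marked basis if $(R_A)_t=(\mathcal H)_t\oplus\langle\mathcal N(J)_t\rangle_A$ for every $t$. For a marked set every $f\in R_A$ has a unique standard representation $f=\sum_{h\in\mathcal H}P_hh+g$ with $P_h$ an $A$-combination of terms in the multiplicative variables of the head term of $h$ and $g\in\langle\mathcal N(J)\rangle_A$; for a marked basis, $g=0$ when $f\in(\mathcal H)$. The system $\Sigma_{\mathcal H}$: let $\mathcal H_0=\{h_{\alpha_1},\dots,h_{\alpha_r}\}$ be the polynomials of $\mathcal H$ with head term divisible by $x_0$; write $h_{\alpha_i}=h'_{\alpha_i}+h''_{\alpha_i}$ with all terms of $h'_{\alpha_i}$ divisible by $x_0$ and no term of $h''_{\alpha_i}$ divisible by $x_0$; for $k=1,\dots,n$ let $A_k$ be the $r\times r$ matrix whose $(i,j)$ entry is the constant term (with respect to the variables $x$) of $P_{h_{\alpha_i}}$ in the standard representation $x_kh_{\alpha_j}=\sum_hP_hh$. Then $\Sigma_{\mathcal H}$ is the homogeneous linear system in the unknowns $\mathbf c=(c_1,\dots,c_r)^T$ consisting of the equations given by the vanishing of all coefficients of $\sum_ic_ih''_{\alpha_i}$ and of $A_k\mathbf c=\mathbf 0$ for $k=1,\dots,n$. The marked scheme $\mathbf{Mf}_J$: it represents the functor $A\mapsto\{(\mathcal H)\subset R_A:\mathcal H\text{ is a }\mathcal P_J\text{-marked basis}\}$ on Noetherian $\mathbb K$-algebras.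 Explicitly $\mathbf{Mf}_J=\mathrm{Spec}(\mathbb K[C]/\mathscr U)$, where $C=\{C_{\alpha\eta}: x^\alpha\in\mathcal P_J,\ x^\eta\in\mathcal N(J),\ |\eta|=|\alpha|\}$, $\mathscr H=\{x^\alpha-\sum_\eta C_{\alpha\eta}x^\eta\}_{x^\alpha\in\mathcal P_J}$, and $\mathscr U$ is generated by the $x$-coefficients of the remainders $g\in\langle\mathcal N(J)\rangle_{\mathbb K[C]}$ in the standard representations of the polynomials $x_ih_\alpha$, with $h_\alpha\in\mathscr H$ and $x_i$ non-multiplicative for $x^\alpha$. A point $p$ with residue field $\kappa(p)$ corresponds to the ideal of $\kappa(p)[x_0,\dots,x_n]$ generated by the specialization of $\mathscr H$ at $p$. An Artinian homogeneous ideal $I\subset R$ is Gorenstein if $R/I$ is a Gorenstein ring, equivalently if its socle $(I:(x_0,\dots,x_n))/I$ has dimension $1$ over the base field. *)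

(* Defs.v *)
From HB Require Import structures.
From mathcomp Require Import all_boot all_order all_algebra finmap.
From mathcomp Require Import ring_quotient fraction.
From mathcomp Require Import mpoly.
From mathcomp Require Import boolp.
From Stdlib Require Import ClassicalEpsilon.

Set Implicit Arguments.
Unset Strict Implicit.
Unset Printing Implicit Defensive.

Import GRing.Theory.

Local Open Scope ring_scope.

Section Ideals.
Variable A : comNzRingType.

(* Prop-valued ideals; unlike [idealr], the unit ideal is allowed. *)
Definition is_ideal (I : A -> Prop) : Prop :=
  I 0 /\ forall a u v, I u -> I v -> I (a * u + v).

Definition ideal_gen (G : A -> Prop) (f : A) : Prop :=
  exists s : seq (A * A),
    (forall ag, ag \in s -> G ag.2) /\ f = \sum_(ag <- s) ag.1 * ag.2.

Definition colon (I D : A -> Prop) (f : A) : Prop :=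
  forall g, D g -> I (g * f).

(* The quotient of A by I is an Artinian ring; its ideals are the ideals of A
   containing I. *)
Definition artinian (I : A -> Prop) : Prop :=
  forall L : nat -> A -> Prop,
    (forall k, is_ideal (L k)) ->
    (forall k f, I f -> L k f) ->
    (forall k f, L k.+1 f -> L k f) ->
    exists N : nat, forall k f, (N <= k)%N -> L N f -> L k f.

End Ideals.

Section Gorenstein.
Variables (F : fieldType) (m : nat).

Definition homogeneous_ideal (I : {mpoly F[m]} -> Prop) : Prop :=
  forall d f, I f -> I (pihomog mdeg d f).

Definition irrelevant : {mpoly F[m]} -> Prop :=
  ideal_gen (fun f => exists i : 'I_m, f = 'X_i).

(* The last clause says that the F-vector space (I : (x_0, ..., x_n)) / I has
   a basis consisting of the class of one element. *)
Definition gorenstein (I : {mpoly F[m]} -> Prop) : Prop :=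
  [/\ is_ideal I, artinian I, homogeneous_ideal I
    & exists s, [/\ colon I irrelevant s, ~ I s
        & forall f, colon I irrelevant f -> exists c : F, I (f - c *: s)]].

End Gorenstein.

Section Monomial.
Variables (K : fieldType) (n : nat).
Implicit Types (J : {mpoly K[n.+1]} -> Prop) (P : {fset 'X_{1..n.+1}}).

Definition monomial_ideal J : Prop :=
  exists S : 'X_{1..n.+1} -> Prop,
    forall f, J f <-> ideal_gen (fun g => exists2 m, S m & g = 'X_[m]) f.

(* x_i <= min(x^a); every variable is multiplicative for the term 1. *)
Definition multiplicative (a : 'X_{1..n.+1}) (i : 'I_n.+1) : Prop :=
  forall j : 'I_n.+1, a j != 0%N -> (i <= j)%N.

(* x^d is a term in the multiplicative variables of x^a, that is,
   max(x^d) <= min(x^a). *)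
Definition mult_term (a d : 'X_{1..n.+1}) : Prop :=
  forall i, d i != 0%N -> multiplicative a i.

Definition pommaret_basis J P : Prop :=
  (forall f, J f <-> ideal_gen (fun g => exists2 a, a \in P & g = 'X_[a]) f) /\
  (forall t : 'X_{1..n.+1}, J 'X_[t] -> t \notin P ->
     exists! s : 'X_{1..n.+1},
       s \in P /\ exists2 d, t = (d + s)%MM & mult_term s d).

(* N(J) *)
Definition nonterm J (m : 'X_{1..n.+1}) : Prop := ~ J 'X_[m].

End Monomial.

(* A family {h_a}, a in P, of polynomials is encoded as a function on all
   terms, of which only the values on P matter. *)
Section Marked.
Variables (K : fieldType) (n : nat) (J : {mpoly K[n.+1]} -> Prop).
Variables (P : {fset 'X_{1..n.+1}}) (A : comNzRingType).
Implicit Types (h q : 'X_{1..n.+1} -> {mpoly A[n.+1]}).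
Implicit Types (f g : {mpoly A[n.+1]}).

Definition marked_set h : Prop :=
  forall a, a \in P ->
    [/\ h a \is (mdeg a).-homog, (h a)@_a = 1
      & forall m, m \in msupp (h a) -> m != a -> nonterm J m].

Definition marked_ideal h : {mpoly A[n.+1]} -> Prop :=
  ideal_gen (fun g => exists2 a, a \in P & g = h a).

(* the A-span of N(J) *)
Definition nonspan g : Prop := forall m, m \in msupp g -> nonterm J m.

Definition marked_basis h : Prop :=
  marked_set h /\
  forall t : nat,
    (forall f, f \is t.-homog ->
       exists u v, [/\ f = u + v, marked_ideal h u, u \is t.-homog,
                       nonspan v & v \is t.-homog]) /\
    (forall f, f \is t.-homog -> marked_ideal h f -> nonspan f -> f = 0).

Definition is_std_rep h f q g : Prop :=
  [/\ f = \sum_(a <- P) q a * h a + g,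
      forall a, a \in P -> forall m, m \in msupp (q a) -> mult_term a m
    & nonspan g].

(* When h is a marked set, the standard representation of f exists, and its
   remainder and its coefficients on P are unique. *)
Definition std_rep h f : ('X_{1..n.+1} -> {mpoly A[n.+1]}) * {mpoly A[n.+1]} :=
  epsilon (inhabits (fun=> 0, 0)) (fun qg => is_std_rep h f qg.1 qg.2).

Definition std_coef h f := (std_rep h f).1.
Definition std_rem h f := (std_rep h f).2.

End Marked.

Section Sigma.
Variables (K : fieldType) (n : nat) (J : {mpoly K[n.+1]} -> Prop).
Variables (P : {fset 'X_{1..n.+1}}) (h : 'X_{1..n.+1} -> {mpoly K[n.+1]}).

Definition heads0 : seq 'X_{1..n.+1} := [seq a : 'X_{1..n.+1} <- P | a ord0 != 0%N].

Definition nheads0 : nat := size heads0.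

Definition head0 (i : 'I_nheads0) : 'X_{1..n.+1} := tnth (in_tuple heads0) i.

(* h'' *)
Definition x0free_part (f : {mpoly K[n.+1]}) : {mpoly K[n.+1]} :=
  \sum_(m <- msupp f | m ord0 == 0%N) f@_m *: 'X_[m].

(* The row of a term x^m expresses the vanishing of the coefficient of x^m in
   \sum_i c_i h''_i; all the terms of the h_a have degree < Sigma_bound. *)
Definition Sigma_bound : nat := \max_(a <- P) msize (h a).

Definition Sigma_x0free :
    'M[K]_(#|{: 'X_{1..n.+1 < Sigma_bound}}|, nheads0) :=
  \matrix_(i, j) (x0free_part (h (head0 j)))@_(bmnm (enum_val i)).

(* A_(k+1), for k < n *)
Definition Sigma_A (k : 'I_n) : 'M[K]_nheads0 :=
  \matrix_(i, j) (std_coef J P h ('X_(lift ord0 k) * h (head0 j)) (head0 i))@_0%MM.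

Definition Sigma_mx :=
  col_mx Sigma_x0free (\mxcol_(k < n) Sigma_A k).

End Sigma.

(* Points of Spec A are the elements of [prime_idealr A]. *)
Section Spec.
Variable A : comNzRingType.

Definition zariski_closed_of (E : A -> Prop) (p : prime_idealr A) : Prop :=
  forall f, E f -> f \in p.

Definition zariski_open (O : prime_idealr A -> Prop) : Prop :=
  exists E : A -> Prop, forall p, O p <-> ~ zariski_closed_of E p.

Definition zariski_open_in (X O : prime_idealr A -> Prop) : Prop :=
  exists2 W, zariski_open W & forall p, O p <-> X p /\ W p.

Variable p : prime_idealr A.

Definition quot_dom : Type := {ideal_quot p}.
HB.instance Definition _ := GRing.ComNzRing.on quot_dom.

(* [{fraction _}] requires an [idomainType], hence a unit predicate and an
   inverse on A / p, which exist classically. *)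
Definition qd_unit : pred quot_dom := fun x => `[< exists y, y * x = 1 >].

Definition qd_inv (x : quot_dom) : quot_dom :=
  if pselect (exists y, y * x = 1) is left e then projT1 (cid e) else x.

Lemma qd_mulVx : {in qd_unit, left_inverse 1 qd_inv *%R}.
Proof.
by move=> x /asboolP ex; rewrite /qd_inv; case: pselect => // e; case: cid.
Qed.

Lemma qd_unitP (x y : quot_dom) : y * x = 1 -> qd_unit x.
Proof. by move=> yx; apply/asboolP; exists y. Qed.

Lemma qd_inv_out : {in [predC qd_unit], qd_inv =1 id}.
Proof.
by move=> x /asboolPn nx; rewrite /qd_inv; case: pselect.
Qed.

HB.instance Definition _ :=
  GRing.ComNzRing_hasMulInverse.Build quot_dom qd_mulVx qd_unitP qd_inv_out.

Lemma qd_idomain : GRing.integral_domain_axiom quot_dom.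
Proof. exact: Quotient.rquot_IdomainAxiom. Qed.

HB.instance Definition _ :=
  GRing.ComUnitRing_isIntegral.Build quot_dom qd_idomain.

Definition residue_field : fieldType := {fraction quot_dom}.

Definition residue (a : A) : residue_field :=
  FracField.tofrac (\pi_({ideal_quot p})%qT a : quot_dom).

End Spec.

Section MarkedScheme.
Variables (K : fieldType) (n : nat) (J : {mpoly K[n.+1]} -> Prop).
Variable P : {fset 'X_{1..n.+1}}.

Definition terms_of_degree (d : nat) : seq 'X_{1..n.+1} :=
  [seq m <- [seq bmnm b | b <- enum {: 'X_{1..n.+1 < d.+1}}] | mdeg m == d].

(* The variables C_(a, e), numbered by their position in the list. *)
Definition Cindex : seq ('X_{1..n.+1} * 'X_{1..n.+1}) :=
  [seq (a, e) | a <- P, e <- [seq e <- terms_of_degree (mdeg a)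
                                 | `[< nonterm J e >]]].

Definition KC : comNzRingType := {mpoly K[size Cindex]}.

Definition univ_marked (a : 'X_{1..n.+1}) : {mpoly KC[n.+1]} :=
  'X_[a] -
  \sum_(i < size Cindex | (tnth (in_tuple Cindex) i).1 == a)
     ('X_i : {mpoly K[size Cindex]}) *: 'X_[(tnth (in_tuple Cindex) i).2].

Definition ideal_U : KC -> Prop :=
  ideal_gen (fun c => exists a i m,
    [/\ a \in P, ~ multiplicative a i
      & c = (std_rem J P univ_marked ('X_i * univ_marked a))@_m]).

(* Spec(K[C]/U), identified with the closed subset V(U) of Spec K[C]; the
   residue fields are the same. *)
Definition Mf : prime_idealr KC -> Prop := zariski_closed_of ideal_U.

Definition point_ideal (p : prime_idealr KC) :
    {mpoly (residue_field p)[n.+1]} -> Prop :=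
  marked_ideal P (fun a => map_mpoly (@residue _ p) (univ_marked a)).

Definition gorenstein_locus (p : prime_idealr KC) : Prop :=
  Mf p /\ gorenstein (@point_ideal p).

End MarkedScheme.

Arguments Mf {K n} J P p.
Arguments gorenstein_locus {K n} J P p.

(* Main.v *)
(** A P_J-marked set is triangular for the lexicographic order on multipliers:
    if x^d x^m, with x^m outside J, equals x^e x^b with b in P_J and e
    multiplicative for b, then e is smaller than d when exponents are compared
    from the largest variable down.  Hence standard representations exist, are
    unique over any coefficient ring, and commute with base change; and if every
    x_i h_a with x_i non-multiplicative reduces to 0, the family generates an
    ideal meeting <N(J)> trivially.

    (i) If g is a combination of terms outside J, then x_0 g is a constant
    combination of the h_a with x_0 | x^a plus a combination of terms outside J.
    So for s in the socle, s = g modulo I, one gets x_0 g = sum_i c_i h_i, and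
    uniqueness of standard representations shows that c solves Sigma;
    conversely a solution c gives the socle element (sum_i c_i h_i) / x_0.  Thus
    the socle is isomorphic to the kernel of Sigma.

    (ii) Over K[C], reduce all x_k x^t with x^t in N(J).  At a point of Mf the
    resulting matrix specializes to that of s |-> (x_0 s, ..., x_n s) on R/I,
    whose rank is at most |N(J)| - 1; the point is Gorenstein when the rank is
    at least |N(J)| - 1, i.e. when some minor of that size does not vanish. *)
Require Import Defs.
From HB Require Import structures.
From mathcomp Require Import all_boot all_order all_algebra finmap.
From mathcomp Require Import mpoly.
From mathcomp Require Import ring_quotient fraction zify boolp.
From Stdlib Require Import ClassicalEpsilon.

Set Implicit Arguments.
Unset Strict Implicit.
Unset Printing Implicit Defensive.

Import GRing.Theory.
(* [GRing.Theory] shadows [Defs.multiplicative]. *)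
Import Defs.

Local Open Scope ring_scope.

(** * Ideals, and the order on multipliers *)

Section IdealGen.
Variable A : comNzRingType.
Implicit Types (I G : A -> Prop).

Lemma ideal_gen_ideal G : is_ideal (ideal_gen G).
Proof.
split; first by exists [::]; rewrite big_nil.
move=> a u v [s [hs ->]] [t [ht ->]].
exists ([seq (a * x.1, x.2) | x <- s] ++ t); split.
  by move=> ag; rewrite mem_cat => /orP[/mapP[x xs ->]|]; [exact: hs xs|exact: ht].
rewrite big_cat big_map /= mulr_sumr; congr (_ + _).
by apply: eq_bigr => x _; rewrite mulrA.
Qed.

Lemma mem_ideal_gen G g : G g -> ideal_gen G g.
Proof.
by move=> Gg; exists [:: (1, g)]; rewrite big_seq1 mul1r; split=> // x; rewrite inE => /eqP ->.
Qed.

Lemma idealD I u v : is_ideal I -> I u -> I v -> I (u + v).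
Proof. by move=> [_ hI] Iu Iv; rewrite -[u]mul1r; apply: hI. Qed.

Lemma idealM I a u : is_ideal I -> I u -> I (a * u).
Proof. by move=> [I0 hI] Iu; rewrite -[_ * _]addr0; apply: hI. Qed.

Lemma idealB I u v : is_ideal I -> I u -> I v -> I (u - v).
Proof. by move=> hI Iu Iv; apply: idealD => //; rewrite -mulN1r; apply: idealM. Qed.

Lemma ideal_sum I (T : eqType) (s : seq T) (f : T -> A) : is_ideal I ->
  (forall x, x \in s -> I (f x)) -> I (\sum_(x <- s) f x).
Proof.
move=> hI hf; rewrite big_seq; elim/big_ind: _ => //; first exact: hI.1.
by move=> u v; apply: idealD.
Qed.

Lemma sub_ideal_gen G I : is_ideal I -> (forall g, G g -> I g) ->
  forall f, ideal_gen G f -> I f.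
Proof.
move=> hI hG f [s [hs ->]]; apply: ideal_sum => // x /hs /hG; exact: idealM.
Qed.

End IdealGen.

Section Weight.
Variables (n B : nat).
Implicit Types d e m : 'X_{1..n}.

(** Exponents are digits in base [B], the largest variable being most significant; lexicographic
    descent becomes descent in nat. *)
Definition lex_weight d : nat := (\sum_(i < n) d i * B ^ i)%N.

Lemma lex_weightD d e : lex_weight (d + e)%MM = (lex_weight d + lex_weight e)%N.
Proof. by rewrite -big_split; apply: eq_bigr => i _ /=; rewrite mnmDE mulnDl. Qed.

(** Since [e] has degree below [B], its digits under position [j] amount to less than [B ^ j] and
    cannot make up for the deficit at [j]. *)
Lemma lex_weight_lt d e (j : 'I_n) :
  (e j < d j)%N -> (forall i : 'I_n, (j < i)%N -> e i = d i) -> (mdeg e < B)%N ->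
  (lex_weight e < lex_weight d)%N.
Proof.
move=> lt_ed eq_ed degB.
have B0 : (0 < B)%N by apply: leq_ltn_trans degB.
have low : (\sum_(i < n | (i < j)%N) e i * B ^ i < B ^ j)%N.
  rewrite -(ltn_pmul2l B0) big_distrr /=.
  apply: leq_ltn_trans (_ : mdeg e * B ^ j < _)%N; last first.
    by rewrite ltn_pmul2r // expn_gt0 B0.
  rewrite mdegE big_distrl /= [X in (_ <= X)%N](bigID (fun i : 'I_n => (i < j)%N)) /=.
  apply: leq_trans (leq_addr _ _); apply: leq_sum => i lt_ij.
  by rewrite mulnCA -expnS leq_mul2l leq_pexp2l ?orbT.
have split_w m : lex_weight m = (\sum_(i < n | (i < j)%N) m i * B ^ i + (m j * B ^ j +
    \sum_(i < n | ~~ (i < j)%N && (i != j)) m i * B ^ i))%N.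
  rewrite /lex_weight (bigID (fun i : 'I_n => (i < j)%N)) /=; congr addn.
  by rewrite (bigD1 j) ?ltnn.
rewrite !split_w.
have -> : (\sum_(i < n | ~~ (i < j)%N && (i != j)) e i * B ^ i =
    \sum_(i < n | ~~ (i < j)%N && (i != j)) d i * B ^ i)%N.
  apply: eq_bigr => i /andP[]; rewrite -leqNgt leq_eqVlt.
  by case/orP => [/eqP/val_inj->|/eq_ed -> //]; rewrite eqxx.
rewrite !addnA ltn_add2r.
apply: leq_trans (_ : B ^ j + e j * B ^ j <= _)%N; first by rewrite ltn_add2r.
by rewrite -mulSn; apply: leq_trans (leq_addl _ _); rewrite leq_mul2r lt_ed orbT.
Qed.

Lemma last_diff d e : d != e ->
  exists2 j : 'I_n, e j != d j & forall i : 'I_n, (j < i)%N -> e i = d i.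
Proof.
move=> neq_de.
have [i0 Pi0] : exists i, e i != d i.
  apply/existsP; apply: contraR neq_de; rewrite negb_exists => /forallP eq_de.
  by apply/eqP/mnmP => i; apply/eqP; rewrite eq_sym -[_ == _]negbK.
case: (@arg_maxnP _ i0 (fun i => e i != d i) (fun i : 'I_n => i : nat) Pi0) => j Pj maxj.
exists j => // i ltji.
by apply/eqP; apply: contraTT ltji => /maxj; rewrite -leqNgt.
Qed.

End Weight.

(** * Pommaret cones, and finiteness of N(J) *)

Section Pommaret.
Variables (K : fieldType) (n : nat) (J : {mpoly K[n.+1]} -> Prop).
Variable P : {fset 'X_{1..n.+1}}.
Hypothesis hP : pommaret_basis J P.
Implicit Types a b d e m t : 'X_{1..n.+1}.

Lemma multiplicative0 a : multiplicative a ord0.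
Proof. by []. Qed.

Lemma mult_term0 a : mult_term a 0%MM.
Proof. by move=> i; rewrite mnm0E. Qed.

Lemma mult_termD a d e : mult_term a d -> mult_term a e -> mult_term a (d + e)%MM.
Proof.
move=> hd he i; rewrite mnmDE addn_eq0 negb_and.
by case/orP; [apply: hd | apply: he].
Qed.

Lemma mult_termU a i : mult_term a U_(i)%MM <-> multiplicative a i.
Proof.
split=> [h|h j]; first by apply: h; rewrite mnm1E eqxx.
by rewrite mnm1E; case: (i =P j) => // <-.
Qed.

Lemma mult_termB a d e : mult_term a d -> mult_term a (d - e)%MM.
Proof. by move=> hd i; rewrite mnmBE => h; apply: hd; apply: contraNneq h => ->. Qed.

Lemma mem_cone b d : b \in P -> J 'X_[d + b].
Proof.
move=> bP; apply/hP.1; rewrite mpolyXD; apply: idealM; first exact: ideal_gen_ideal.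
by apply: mem_ideal_gen; exists b.
Qed.

Lemma cone_exists t : J 'X_[t] ->
  exists b d, [/\ b \in P, t = (d + b)%MM & mult_term b d].
Proof.
move=> Jt; have [tP|tP] := boolP (t \in P).
  by exists t, 0%MM; split; rewrite ?add0m //; apply: mult_term0.
have [b [[bP [d et md]] _]] := hP.2 t Jt tP.
by exists b, d.
Qed.

(* The clause of [pommaret_basis] on unique factorization says nothing about
   the terms of P; multiplying by a large power of x_0 leaves P. *)
Lemma cone_unique a b d e : a \in P -> b \in P -> mult_term a d -> mult_term b e ->
  (d + a = e + b)%MM -> a = b.
Proof.
move=> aP bP ma mb eq_t.
pose N := (\max_(c <- P) mdeg c).+1; pose u := (U_(ord0 : 'I_n.+1) *+ N)%MM.
have mu c : mult_term c u.
  move=> i; rewrite mulmnE mnm1E; case: (ord0 =P i) => [<- _|_]; first exact: multiplicative0.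
  by rewrite mul0n.
have tP : (u + (d + a))%MM \notin P.
  apply/negP => tP.
  have := @leq_bigmax_seq _ _ xpredT (fun c : 'X_{1..n.+1} => mdeg c) _ tP isT.
  rewrite leqNgt => /negP; apply; rewrite mdegD mdegMn mdeg1 mul1n.
  exact: leq_addr.
have Jt : J 'X_[u + (d + a)] by rewrite addmA; apply: mem_cone.
have [c [_ uc]] := hP.2 _ Jt tP.
have <- : c = a.
  by apply: uc; split=> //; exists (u + d)%MM; rewrite ?addmA //; apply: mult_termD.
apply: uc; split=> //; exists (u + e)%MM; last exact: mult_termD.
by rewrite eq_t addmA.
Qed.

(* Rewriting x^d x^m by its factorization through P lowers the multiplier
   lexicographically, unless x^m was already in the cone. *)
Lemma cone_lt B b d e m : mult_term b e -> (d + m = e + b)%MM ->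
  (forall f, m = (f + b)%MM -> mult_term b f -> e = (d + f)%MM -> False) ->
  (mdeg e < B)%N -> (lex_weight B e < lex_weight B d)%N.
Proof.
move=> mbe eq_t notin degB.
have eq_i i : (d i + m i = e i + b i)%N by rewrite -!mnmDE eq_t.
have le_de : ~ (d <= e)%MM.
  move=> /submK; rewrite addmC => eq_e; apply: (notin (e - d)%MM) => //.
  - by apply: (@addmI _ d); rewrite eq_t addmA eq_e.
  - exact: mult_termB.
have [eq_de|neq_de] := eqVneq d e; first by case: le_de; rewrite eq_de lepm_refl.
have [j neq_j eq_j] := last_diff neq_de.
apply: (lex_weight_lt (j := j)) => //; rewrite ltn_neqAle neq_j /= leqNgt.
(* If [d j < e j], then x_j is multiplicative for [b], so [b] vanishes below [j] and [e] is at least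
   [d] there; hence x^d divides x^e, which was excluded. *)
apply/negP => lt_j; apply: le_de; apply/mnm_lepP => i.
case: (ltngtP i j) => [lt_ij|/eq_j -> //|/val_inj -> //]; last exact: ltnW.
have b_i : b i = 0%N.
  apply/eqP; apply: contraTT lt_ij => bi; rewrite -leqNgt.
  by apply: (mbe j) => //; rewrite -lt0n; apply: leq_trans lt_j.
by move: (eq_i i); rewrite b_i addn0 => <-; apply: leq_addr.
Qed.

Lemma cone_lt_nonterm B b d e m : b \in P -> mult_term b e -> (d + m = e + b)%MM ->
  nonterm J m -> (mdeg e < B)%N -> (lex_weight B e < lex_weight B d)%N.
Proof.
move=> bP mbe eq_t Nm; apply: cone_lt eq_t _ => // f em _ _.
by apply: Nm; rewrite em; apply: mem_cone.
Qed.

(** In the exceptional case of [cone_lt], x^a lies in the cone of [b]; uniqueness gives [a = b], and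
    x_i, a factor of x^e, would be multiplicative for [a]. *)
Lemma cone_lt_nonmult B a b i e : a \in P -> b \in P -> mult_term b e ->
  ~ multiplicative a i -> (U_(i) + a = e + b)%MM -> (mdeg e < B)%N ->
  (lex_weight B e < lex_weight B U_(i)%MM)%N.
Proof.
move=> aP bP mbe nmult eq_t; apply: cone_lt eq_t _ => // f ea mf ee.
have eq_ab : a = b.
  by apply: (@cone_unique a b 0 f) => //; rewrite ?add0m //; apply: mult_term0.
apply: nmult; apply/mult_termU; rewrite eq_ab => j hj; apply: mbe.
by rewrite ee mnmDE addn_eq0 negb_and hj.
Qed.

Hypothesis hA : artinian J.

Lemma mem_monomial t : J 'X_[t] -> exists2 b, b \in P & (b <= t)%MM.
Proof.
by case/cone_exists => b [d [bP -> _]]; exists b => //; apply: lem_addl.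
Qed.

(** The chain of ideals J + (x_i^k) stabilizes at some N. Then x_i^N lies in J + (x_i^(N+1)) and, by
    degree, is a multiple of a generator of J. *)
Lemma power_mem (i : 'I_n.+1) : exists N, J 'X_[U_(i) *+ N].
Proof.
pose L k := ideal_gen (fun g : {mpoly K[n.+1]} =>
  (exists2 a, a \in P & g = 'X_[a]) \/ g = 'X_[U_(i) *+ k]).
have idL k : is_ideal (L k) by apply: ideal_gen_ideal.
have [||N hN] := hA idL.
- move=> k f /hP.1; apply: sub_ideal_gen => // g hg.
  by apply: mem_ideal_gen; left.
- move=> k; apply: sub_ideal_gen => // g [hg|->]; first by apply: mem_ideal_gen; left.
  by rewrite mulmS mpolyXD; apply: idealM => //; apply: mem_ideal_gen; right.
have := hN _ 'X_[U_(i) *+ N] (leqnSn N).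
case; first by apply: mem_ideal_gen; right.
move=> s [hs eX]; exists N.
have : ('X_[U_(i) *+ N] : {mpoly K[n.+1]})@_(U_(i) *+ N) != 0.
  by rewrite mcoeffX eqxx oner_neq0.
rewrite {1}eX raddf_sum /= => nz.
have [ag ags nz_ag] : exists2 ag, ag \in s & (ag.1 * ag.2)@_(U_(i) *+ N) != 0.
  apply/hasP; apply: contraNT nz; rewrite -all_predC => /allP h.
  by rewrite big_seq big1 // => ag /h /= /negbNE /eqP.
move: nz_ag; rewrite -mcoeff_msupp => /msuppM_le /allpairsP [[u v] /= [_ + eq_u]].
have [[a aP ->]|->] := hs _ ags; rewrite msuppX inE => /eqP ev.
  by rewrite eq_u ev; apply: mem_cone.
move: (congr1 (fun m : 'X_{1..n.+1} => m i) eq_u).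
by rewrite mnmDE ev !mulmnE mnm1E eqxx; lia.
Qed.

Lemma nonterm_bounded : exists D, forall t, nonterm J t -> (mdeg t < D)%N.
Proof.
have [N hN] := boolp.choice (P := fun (i : 'I_n.+1) N => J 'X_[U_(i) *+ N]) power_mem.
exists (\sum_i N i).+1 => t Nt; rewrite ltnS mdegE; apply: leq_sum => i _.
rewrite leqNgt; apply/negP => lt_i; apply: Nt.
have [b bP le_b] := mem_monomial (hN i).
have le_t : (b <= t)%MM.
  apply: lepm_trans le_b _; apply/mnm_lepP => j; rewrite mulmnE mnm1E.
  by case: (i =P j) => [<-|_]; rewrite ?mul1n ?mul0n // ltnW.
by rewrite -(submK le_t); apply: mem_cone.
Qed.

End Pommaret.

(** * Standard representations *)

Section Support.
Variables (n : nat) (A : comNzRingType) (Q : 'X_{1..n} -> Prop).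
Implicit Types f g : {mpoly A[n]}.

(** Both [nonspan] and the condition on multipliers in [is_std_rep] unfold to instances of this
    predicate. *)
Definition supp_in f : Prop := forall m, m \in msupp f -> Q m.

Lemma supp_inP f : supp_in f <-> forall m, ~ Q m -> f@_m = 0.
Proof.
split=> h m; last by move=> mf; apply: contrapT => /h /eqP; rewrite mcoeff_eq0 mf.
by move=> Qm; apply: memN_msupp_eq0; apply/negP => /h.
Qed.

Lemma supp_in0 : supp_in 0.
Proof. by apply/supp_inP => m _; rewrite mcoeff0. Qed.

Lemma supp_inX m : Q m -> supp_in 'X_[m].
Proof. by move=> Qm m'; rewrite msuppX inE => /eqP ->. Qed.

Lemma supp_inZ c f : supp_in f -> supp_in (c *: f).
Proof. by move=> /supp_inP hf; apply/supp_inP => m /hf; rewrite mcoeffZ => ->; rewrite mulr0. Qed.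

Lemma supp_inD f g : supp_in f -> supp_in g -> supp_in (f + g).
Proof.
move=> /supp_inP hf /supp_inP hg; apply/supp_inP => m Qm.
by rewrite mcoeffD hf ?hg ?addr0.
Qed.

Lemma supp_inN f : supp_in f -> supp_in (- f).
Proof. by rewrite -scaleN1r; apply: supp_inZ. Qed.

Lemma supp_in_sum (I : eqType) (s : seq I) (F : I -> {mpoly A[n]}) :
  (forall i, i \in s -> supp_in (F i)) -> supp_in (\sum_(i <- s) F i).
Proof.
move=> hF; rewrite big_seq; elim/big_ind: _ => //; first exact: supp_in0.
exact: supp_inD.
Qed.

Lemma supp_in_pihomog d f : supp_in f -> supp_in (pihomog mdeg d f).
Proof.
move=> hf; rewrite pihomogE -big_filter; apply: supp_in_sum => m.
by rewrite mem_filter => /andP[_ /hf]; move=> Qm; apply/supp_inZ/supp_inX.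
Qed.

End Support.

Lemma mcoeffM_neq0 (n : nat) (A : comNzRingType) (f g : {mpoly A[n]}) m :
  (f * g)@_m != 0 -> exists d e, [/\ d \in msupp f, e \in msupp g & m = (d + e)%MM].
Proof.
rewrite -mcoeff_msupp => /msuppM_le /allpairsP [[d e] /= [df eg ->]].
by exists d, e.
Qed.

Section StdRep.
Variables (K : fieldType) (n : nat) (J : {mpoly K[n.+1]} -> Prop).
Variable P : {fset 'X_{1..n.+1}}.
Hypothesis hP : pommaret_basis J P.
Variables (A : comNzRingType) (h : 'X_{1..n.+1} -> {mpoly A[n.+1]}).
Hypothesis hM : marked_set J P h.
Implicit Types (a b d e m : 'X_{1..n.+1}) (f g : {mpoly A[n.+1]}).
Implicit Types q : 'X_{1..n.+1} -> {mpoly A[n.+1]}.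

Local Notation is_std_rep := (@is_std_rep K n J P A h).

Lemma marked_tail a : a \in P -> nonspan J (h a - 'X_[a]).
Proof.
move=> aP m mt; have [_ ha1 ha] := hM aP.
have [em|ne] := eqVneq m a.
  by move: mt; rewrite mcoeff_msupp em mcoeffB mcoeffX eqxx ha1 subrr eqxx.
apply: ha (ne); rewrite mcoeff_msupp; move: mt.
by rewrite mcoeff_msupp mcoeffB mcoeffX [a == m]eq_sym (negbTE ne) subr0.
Qed.

Lemma marked_tail_deg a m : a \in P -> m \in msupp (h a - 'X_[a]) -> mdeg m = mdeg a.
Proof.
move=> aP; have [hom _ _] := hM aP.
have /dhomogP : h a - 'X_[a] \is (mdeg a).-homog.
  by apply: rpredB => //; rewrite dhomogX.
by apply.
Qed.

Lemma std_repD f f' q q' g g' : is_std_rep f q g -> is_std_rep f' q' g' ->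
  is_std_rep (f + f') (fun a => q a + q' a) (g + g').
Proof.
move=> [ef hq hg] [ef' hq' hg']; split.
- rewrite ef ef' addrACA -big_split; congr (_ + _).
  by apply: eq_bigr => a _ /=; rewrite mulrDl.
- by move=> a aP; apply: (@supp_inD _ _ (mult_term a)); [apply: hq | apply: hq'].
- exact: supp_inD.
Qed.

Lemma std_repZ c f q g : is_std_rep f q g -> is_std_rep (c *: f) (fun a => c *: q a) (c *: g).
Proof.
move=> [ef hq hg]; split.
- rewrite ef scalerDr scaler_sumr; congr (_ + _).
  by apply: eq_bigr => a _; rewrite scalerAl.
- by move=> a aP; apply: (@supp_inZ _ _ (mult_term a)); apply: hq.
- exact: supp_inZ.
Qed.

Lemma std_repB f f' q q' g g' : is_std_rep f q g -> is_std_rep f' q' g' ->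
  is_std_rep (f - f') (fun a => q a - q' a) (g - g').
Proof.
move=> r /(std_repZ (-1)) /(std_repD r); rewrite !scaleN1r.
by under [in X in X -> _]eq_fun do rewrite scaleN1r.
Qed.

Lemma std_rep_nonspan g : nonspan J g -> is_std_rep g (fun=> 0) g.
Proof.
move=> hg; split=> //; last by move=> a _; apply: (@supp_in0 _ _ (mult_term a)).
by rewrite big1 ?add0r // => a _; rewrite mul0r.
Qed.

Lemma std_rep_head b q : b \in P -> supp_in (mult_term b) (q b) ->
  is_std_rep (q b * h b) (fun a => if a == b then q b else 0) 0.
Proof.
move=> bP hq; split; last exact: (@supp_in0 _ _ (nonterm J)).
  rewrite addr0 (bigD1_seq b) ?fset_uniq //= eqxx big1 ?addr0 // => a /negbTE ->.
  by rewrite mul0r.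
by move=> a _; case: eqP => [->|_] //; apply: (@supp_in0 _ _ (mult_term a)).
Qed.

(* By [cone_lt], nothing cancels the head of a multiple of h_b whose multiplier
   has maximal weight. *)
Lemma std_rep_top B f q g : is_std_rep f q g ->
  (forall a d, a \in P -> d \in msupp (q a) -> (mdeg d < B)%N) ->
  forall a d, a \in P -> d \in msupp (q a) ->
  exists b e, [/\ b \in P, mult_term b e, (mdeg e < B)%N,
    (lex_weight B d <= lex_weight B e)%N & (e + b)%MM \in msupp f].
Proof.
move=> [ef hq hg] degB a0 d0 a0P d0q.
pose s := [seq (b, e) | b <- P, e <- msupp (q b)].
have in_s b e : (b, e) \in s -> b \in P /\ e \in msupp (q b).
  by case/allpairsPdep => x [y [xP yq [-> ->]]].
have s_in b e : b \in P -> e \in msupp (q b) -> (b, e) \in s.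
  by move=> bP eq; apply/allpairsPdep; exists b, e.
have exw : exists k, has (fun x => lex_weight B x.2 == k) s.
  by exists (lex_weight B d0); apply/hasP; exists (a0, d0); rewrite ?s_in /=.
have ubw k : has (fun x => lex_weight B x.2 == k) s ->
    (k <= \max_(x <- s) lex_weight B x.2)%N.
  case/hasP => x xs /eqP <-.
  exact: (@leq_bigmax_seq _ s xpredT (fun x => lex_weight B x.2) x xs isT).
case: (ex_maxnP exw ubw) => k /hasP [[b e] /in_s [bP eq] /= /eqP we] maxk.
have le_e a d : a \in P -> d \in msupp (q a) -> (lex_weight B d <= lex_weight B e)%N.
  move=> aP dq; rewrite we; apply: maxk; apply/hasP.
  by exists (a, d); rewrite ?s_in /=.
have mbe := hq _ bP _ eq; have dege := degB _ _ bP eq.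
exists b, e; split=> //; first exact: le_e d0q.
have no_low a d m : a \in P -> d \in msupp (q a) -> (e + b = d + m)%MM -> ~ nonterm J m.
  move=> aP dq eq_t Nm.
  have := cone_lt_nonterm hP bP mbe (esym eq_t) Nm dege.
  by rewrite ltnNge (le_e a).
(* Only the head of h_b contributes to this coefficient: the remainder avoids J, other heads are
   excluded by [cone_unique], and tails by [no_low]. *)
rewrite mcoeff_msupp; suff -> : f@_(e + b) = (q b)@_e by rewrite -mcoeff_msupp.
rewrite ef mcoeffD raddf_sum /= (bigD1_seq b) ?fset_uniq //=.
rewrite [g@__]memN_msupp_eq0 ?addr0; last first.
  by apply/negP => /hg; apply; apply: (mem_cone hP).
rewrite [X in _ + X]big_seq_cond big1 ?addr0; last first.
  move=> a /andP [aP neq_ab]; apply/eqP; apply: contraNT neq_ab.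
  case/mcoeffM_neq0 => d [m [dq mh eq_t]].
  have [em|nem] := eqVneq m a.
    rewrite em in eq_t; have <- := cone_unique hP bP aP mbe (hq _ aP _ dq) eq_t.
    exact: eqxx.
  by have [_ _ /(_ m mh nem)] := hM aP; case/(no_low a d m aP dq eq_t).
rewrite -(subrK 'X_[b] (h b)) mulrDr mcoeffD [(e + b)%MM]addmC mcoeffMX.
rewrite [X in X + _]( _ : _ = 0) ?add0r //; apply/eqP/negbNE/negP.
case/mcoeffM_neq0 => d [m [dq mh eq_t]]; rewrite addmC in eq_t.
exact: no_low dq eq_t (marked_tail bP mh).
Qed.

(** By [std_rep_top], a nonzero multiplier would produce a term in the support of 0. *)
Lemma std_rep_eq0 q g : is_std_rep 0 q g -> {in P, forall a, q a = 0} /\ g = 0.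
Proof.
move=> r; pose B := \max_(a <- P) msize (q a).
have degB a d : a \in P -> d \in msupp (q a) -> (mdeg d < B)%N.
  move=> aP /msize_mdeg_lt /leq_trans; apply.
  exact: (@leq_bigmax_seq _ _ xpredT (fun a => msize (q a)) a aP isT).
have q0 : {in P, forall a, q a = 0}.
  move=> a aP; apply: msuppnil0; case eq_s: (msupp _) => [//|d s].
  have dq : d \in msupp (q a) by rewrite eq_s mem_head.
  have [b [e [_ _ _ _]]] := std_rep_top r degB aP dq.
  by rewrite msupp0 in_nil.
split=> //; case: r => + _ _; rewrite big_seq big1 ?add0r // => a aP.
by rewrite q0 // mul0r.
Qed.

Lemma std_rep_unique f q q' g g' : is_std_rep f q g -> is_std_rep f q' g' ->
  {in P, q =1 q'} /\ g = g'.
Proof.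
move=> r r'; move: (std_repB r r'); rewrite subrr => /std_rep_eq0 [q0 /eqP].
rewrite subr_eq0 => /eqP ->; split=> // a /q0 /eqP.
by rewrite subr_eq0 => /eqP.
Qed.

Definition has_std_rep f : Prop := exists q g, is_std_rep f q g.

Lemma has_std_rep_sum (I : eqType) (s : seq I) (F : I -> {mpoly A[n.+1]}) :
  (forall i, i \in s -> has_std_rep (F i)) -> has_std_rep (\sum_(i <- s) F i).
Proof.
move=> hF; rewrite big_seq; elim/big_ind: _ => //.
- by exists (fun=> 0), 0; apply: std_rep_nonspan; apply: (@supp_in0 _ _ (nonterm J)).
- by move=> f f' [q [g r]] [q' [g' r']]; exists (fun a => q a + q' a), (g + g'); apply: std_repD.
Qed.

Lemma has_std_repZ c f : has_std_rep f -> has_std_rep (c *: f).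
Proof. by move=> [q [g r]]; exists (fun a => c *: q a), (c *: g); apply: std_repZ. Qed.

(** Replace x^d x^b by x^d h_b minus x^d times the tail. This terminates: by [cone_lt_nonterm], the
    new terms that lie in J have multipliers of smaller weight. *)
Lemma has_std_repX m : has_std_rep 'X_[m].
Proof.
have nonJ t : ~ J 'X_[t] -> has_std_rep 'X_[t].
  move=> Nt; exists (fun=> 0), 'X_[t]; apply: std_rep_nonspan.
  exact: (@supp_inX _ _ (nonterm J)).
have [/(cone_exists hP) [b [d [bP -> mbd]]]|/nonJ //] := pselect (J 'X_[m]).
(* The h_b are homogeneous, so the degree D is preserved and the single base D + 1 serves for the
   whole reduction. *)
move: {2}(mdeg (d + b)%MM) (erefl (mdeg (d + b)%MM)) => D eqD.
suff key N : forall b d, b \in P -> mult_term b d -> (lex_weight D.+1 d < N)%N ->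
    mdeg (d + b)%MM = D -> has_std_rep 'X_[d + b] by apply: key mbd (ltnSn _) eqD.
elim: N => {b d bP mbd eqD} // N IH b d bP mbd ltN eq_deg.
have -> : 'X_[d + b] = 'X_[d] * h b + (-1) *: ('X_[d] * (h b - 'X_[b])).
  by rewrite scaleN1r -mulrN opprB -mulrDr addrC subrK mpolyXD.
have tail : has_std_rep ((-1) *: ('X_[d] * (h b - 'X_[b]))).
  apply: has_std_repZ; rewrite [h b - _]mpolyE mulr_sumr; apply: has_std_rep_sum.
  move=> t tt; rewrite -scalerAr -mpolyXD; apply: has_std_repZ.
  have [/(cone_exists hP) [b' [d' [b'P et mbd']]]|/nonJ //] := pselect (J 'X_[d + t]).
  have degt : mdeg (d' + b')%MM = D.
    by rewrite -et -eq_deg !mdegD (marked_tail_deg bP tt).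
  rewrite et; apply: IH => //; rewrite ltnS in ltN; apply: leq_trans ltN.
  apply: (cone_lt_nonterm hP b'P mbd' et (marked_tail bP tt)).
  by rewrite ltnS -degt mdegD leq_addr.
case: tail => q [g r].
exists (fun a => (if a == b then 'X_[d] else 0) + q a), (0 + g).
by apply: std_repD r; apply: (@std_rep_head b (fun=> 'X_[d])) => //; apply: supp_inX.
Qed.

Lemma std_rep_exists f : has_std_rep f.
Proof.
rewrite [f]mpolyE; apply: has_std_rep_sum => m _.
by apply: has_std_repZ; apply: has_std_repX.
Qed.

Lemma std_repP f : is_std_rep f (std_coef J P h f) (std_rem J P h f).
Proof.
rewrite /std_coef /std_rem /std_rep.
have [q [g r]] := std_rep_exists f.
exact: (epsilon_spec _ (fun qg => is_std_rep f qg.1 qg.2) (ex_intro _ (q, g) r)).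
Qed.

(** Meant for x_0, which is multiplicative for every term. The remainder is 0 because a multiple of
    a term of N(J) may fall in J. *)
Lemma std_repM d f q : (forall a, a \in P -> mult_term a d) ->
  is_std_rep f q 0 -> is_std_rep ('X_[d] * f) (fun a => 'X_[d] * q a) 0.
Proof.
move=> md [ef hq hg]; split=> //.
  rewrite ef !addr0 mulr_sumr; by apply: eq_bigr => a _; rewrite mulrA.
move=> a aP m /msuppM_le /allpairsP [[x y] /= []].
rewrite msuppX inE => /eqP -> yq ->.
by apply: mult_termD; [apply: md | apply: hq].
Qed.

End StdRep.

(** * The reduction criterion *)

Section Ideal.
Variables (K : fieldType) (n : nat) (J : {mpoly K[n.+1]} -> Prop).
Variable P : {fset 'X_{1..n.+1}}.
Hypothesis hP : pommaret_basis J P.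
Variables (A : comNzRingType) (h : 'X_{1..n.+1} -> {mpoly A[n.+1]}).
Hypothesis hM : marked_set J P h.
Implicit Types (a b d e m : 'X_{1..n.+1}) (f g : {mpoly A[n.+1]}).
Implicit Types q : 'X_{1..n.+1} -> {mpoly A[n.+1]}.

Local Notation is_std_rep := (@is_std_rep K n J P A h).

(* The family meets the A-span of N(J) trivially: for marked sets this is
   equivalent to being a marked basis. *)
Definition reduced : Prop := forall f, marked_ideal P h f -> nonspan J f -> f = 0.

Lemma marked_ideal_ideal : is_ideal (marked_ideal P h).
Proof. exact: ideal_gen_ideal. Qed.

Lemma mem_marked_ideal a : a \in P -> marked_ideal P h (h a).
Proof. by move=> aP; apply: mem_ideal_gen; exists a. Qed.

Lemma std_rep_mem f q g : is_std_rep f q g -> marked_ideal P h (f - g).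
Proof.
move=> [-> _ _]; rewrite addrK; apply: ideal_sum; first exact: marked_ideal_ideal.
by move=> a aP; apply: idealM; [apply: marked_ideal_ideal | apply: mem_marked_ideal].
Qed.

Lemma reduced_rem f q g : reduced -> marked_ideal P h f -> is_std_rep f q g -> g = 0.
Proof.
move=> red If r; have [_ _ gN] := r; apply: red gN.
rewrite -[g](subKr f); apply: idealB => //; first exact: marked_ideal_ideal.
exact: std_rep_mem r.
Qed.

Lemma marked_ideal_homogeneous (d : nat) f : marked_ideal P h f ->
  marked_ideal P h (pihomog mdeg d f).
Proof.
have hI := marked_ideal_ideal.
move=> [s [hs ->]]; rewrite linear_sum; apply: ideal_sum => // ag /hs [a aP ->].
rewrite [ag.1]mpolyE mulr_suml linear_sum; apply: ideal_sum => // m _ /=.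
rewrite -scalerAl linearZ /= -mul_mpolyC; apply: idealM => //.
have hom : 'X_[m] * h a \is (mdeg m + mdeg a).-homog.
  by apply: dhomogM; [rewrite dhomogX | have [] := hM aP].
have [<-|ne] := eqVneq (mdeg m + mdeg a)%N d.
  by rewrite pihomog_dE //; apply: idealM => //; apply: mem_marked_ideal.
by rewrite (pihomog_ne0 ne) //; case: hI.
Qed.

(** A marked basis gives trivial intersection degree by degree; homogeneous components stay both in
    the ideal and in the span of N(J). *)
Lemma marked_basis_reduced : marked_basis J P h -> reduced.
Proof.
move=> [_ hB] f If Nf; rewrite (pihomog_partitionE (leqnn (mmeasure mdeg f))).
rewrite big1 // => d _; apply: (hB d).2; first exact: pihomogP.
  exact: marked_ideal_homogeneous.
exact: supp_in_pihomog.
Qed.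

Lemma in_span_sum (I : eqType) (s : seq I) (F : I -> {mpoly A[n.+1]}) :
  (forall i, i \in s -> exists q, is_std_rep (F i) q 0) ->
  exists q, is_std_rep (\sum_(i <- s) F i) q 0.
Proof.
move=> hF; rewrite big_seq; elim/big_ind: _ => //.
  by exists (fun=> 0); apply: std_rep_nonspan; apply: (@supp_in0 _ _ (nonterm J)).
move=> f f' [q r] [q' r']; exists (fun a => q a + q' a).
by rewrite -[X in is_std_rep _ _ X]addr0; apply: std_repD.
Qed.

Lemma in_spanZ c f : (exists q, is_std_rep f q 0) -> exists q, is_std_rep (c *: f) q 0.
Proof.
move=> [q r]; exists (fun a => c *: q a).
by rewrite -[X in is_std_rep _ _ X](scaler0 _ c); apply: std_repZ.
Qed.

Hypothesis hU : forall a i, a \in P -> ~ multiplicative a i ->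
  exists q, is_std_rep ('X_i * h a) q 0.

(** Induction on the weight of [d]: for a non-multiplicative factor x_i of x^d, replace x_i h_a by
    its combination of the h_b. By [std_rep_top], the new multipliers weigh at most as much as the
    cone multiplier of some term x_i x^m of x_i h_a. *)
Lemma in_span_head d a : a \in P -> exists q, is_std_rep ('X_[d] * h a) q 0.
Proof.
have exQ (x : 'X_{1..n.+1} * 'I_n.+1) : exists q, x.1 \in P ->
    ~ multiplicative x.1 x.2 -> is_std_rep ('X_(x.2) * h x.1) q 0.
  have [[xP xm]|nx] := pselect (x.1 \in P /\ ~ multiplicative x.1 x.2).
    by have [q r] := hU xP xm; exists q.
  by exists (fun=> 0) => xP xm; case: nx.
have [Q hQ] := boolp.choice exQ.
pose B := \max_(c <- P) \max_i \max_(b <- P) msize (Q (c, i) b).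
have degB c i b e : c \in P -> b \in P -> e \in msupp (Q (c, i) b) -> (mdeg e < B)%N.
  move=> cP bP /msize_mdeg_lt /leq_trans; apply.
  apply: leq_trans (_ : \max_i \max_(b <- P) msize (Q (c, i) b) <= _)%N.
    apply: leq_trans (_ : \max_(b <- P) msize (Q (c, i) b) <= _)%N.
      exact: (@leq_bigmax_seq _ _ xpredT (fun b => msize (Q (c, i) b)) b bP isT).
    exact: (@leq_bigmax _ (fun i => \max_(b <- P) msize (Q (c, i) b)) i).
  exact: (@leq_bigmax_seq _ _ xpredT
    (fun c => \max_i \max_(b <- P) msize (Q (c, i) b)) c cP isT).
elim: (lex_weight B d).+1 {-2}d (ltnSn (lex_weight B d)) a => // N IH {}d ltN a aP.
have [md|] := pselect (mult_term a d).
  exists (fun b => if b == a then 'X_[d] else 0).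
  by apply: (@std_rep_head _ _ _ _ _ _ a (fun=> 'X_[d])) => //; apply: supp_inX.
move=> /existsNP [i /not_implyP [di nmult]].
have r := hQ (a, i) aP nmult.
have -> : 'X_[d] = 'X_[d - U_(i)] * 'X_i :> {mpoly A[n.+1]}.
  by rewrite -mpolyXD submK // lep1mP.
rewrite -mulrA; case: (r) => /= -> _ _; rewrite addr0 mulr_sumr.
apply: in_span_sum => b bP; rewrite mulrA [Q _ b]mpolyE mulr_sumr mulr_suml.
apply: in_span_sum => e eQ; rewrite -scalerAr -scalerAl -mpolyXD.
apply: in_spanZ; apply: IH => //; rewrite ltnS in ltN; apply: leq_trans ltN.
rewrite -{2}(@submK _ U_(i)%MM d) ?lep1mP // !lex_weightD ltn_add2l.
have degQ c u : c \in P -> u \in msupp (Q (a, i) c) -> (mdeg u < B)%N by apply: degB.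
have [b' [e' [b'P mb' dege' le_w]]] := std_rep_top hP hM r degQ bP eQ.
rewrite mcoeff_msupp => /mcoeffM_neq0 [u [m [+ mh]]].
rewrite msuppX inE => /eqP -> eq_t; apply: leq_ltn_trans le_w _.
(* x^m is the head of h_a, for which x_i is non-multiplicative, or a term of N(J); in both cases the
   cone multiplier weighs less than x_i. *)
have [em|nem] := eqVneq m a.
  by apply: (cone_lt_nonmult hP aP b'P mb' nmult) => //; rewrite eq_t em.
apply: (cone_lt_nonterm hP b'P mb' (esym eq_t)) => //.
by have [_ _] := hM aP; apply.
Qed.

(** Such an [f] has two standard representations, one with remainder 0 and one with all multipliers
    0; uniqueness makes it 0. *)
Lemma criterion_reduced : reduced.
Proof.
move=> f [s [hs ->]] Nf.
have [q r] : exists q, is_std_rep (\sum_(ag <- s) ag.1 * ag.2) q 0.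
  apply: in_span_sum => ag /hs [a aP ->].
  rewrite [ag.1]mpolyE mulr_suml; apply: in_span_sum => m _.
  by rewrite -scalerAl; apply: in_spanZ; apply: in_span_head.
have r' := @std_rep_nonspan _ _ _ P _ h _ Nf.
by have [_ <-] := std_rep_unique hP hM r r'.
Qed.

End Ideal.

(** * Subspaces, kernels and minors *)

Section LinearAlgebra.
Variable F : fieldType.

(** Take [B] of maximal rank among the matrices with row space inside [V]: adjoining a vector of [V]
    cannot raise the rank. *)
Lemma subspace_rowspan (v : nat) (V : 'rV[F]_v -> Prop) : V 0 ->
  (forall a x y, V x -> V y -> V (a *: x + y)) ->
  exists B : 'M[F]_v, forall c, V c <-> (c <= B)%MS.
Proof.
move=> V0 Vlin.
pose sub (B : 'M[F]_v) := forall c : 'rV_v, (c <= B)%MS -> V c.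
have ex : exists k, `[< exists2 B, sub B & \rank B = k >].
  exists 0%N; apply/asboolP; exists 0; last exact: mxrank0.
  by move=> c; rewrite submx0 => /eqP ->.
have ub k : `[< exists2 B, sub B & \rank B = k >] -> (k <= v)%N.
  by move=> /asboolP [B _ <-]; apply: rank_leq_row.
case: (ex_maxnP ex ub) => k /asboolP [B subB rB] maxB; exists B => c.
split=> [Vc|]; last exact: subB.
have subBc : sub (B + c)%MS.
  move=> c' /sub_addsmxP [[x y] /= ->].
  rewrite [y]mx11_scalar mul_scalar_mx addrC; apply: Vlin => //.
  by apply: subB; apply: submxMl.
have /maxB le_r : `[< exists2 C, sub C & \rank C = \rank (B + c)%MS >].
  by apply/asboolP; exists (B + c)%MS.
rewrite -rB in le_r.
apply: submx_trans (addsmxSr B c) _.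
by rewrite -(mxrank_leqif_sup (addsmxSl B c)) eqn_leq le_r mxrankS ?addsmxSl.
Qed.

Lemma subspace_chain (v : nat) (V : nat -> 'rV[F]_v -> Prop) :
  (forall k, V k 0) -> (forall k a x y, V k x -> V k y -> V k (a *: x + y)) ->
  (forall k x, V k.+1 x -> V k x) ->
  exists N, forall k x, (N <= k)%N -> V N x -> V k x.
Proof.
move=> V0 Vlin Vdec.
have [B hB] := boolp.choice (fun k => subspace_rowspan (V0 k) (Vlin k)).
have ex : exists r, `[< exists k, \rank (B k) = r >].
  by exists (\rank (B 0%N)); apply/asboolP; exists 0%N.
case: (ex_minnP ex) => r /asboolP [N rN] minr; exists N => k x le_Nk.
have dec : forall x, V k x -> V N x.
  move: le_Nk => /subnK <-; elim: (k - N)%N => // m IH y; rewrite addSn => /Vdec; exact: IH.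
have sB : (B k <= B N)%MS.
  by apply/row_subP => i; apply/hB/dec/hB/row_sub.
have le_r : (\rank (B N) <= \rank (B k))%N by rewrite rN; apply: minr; apply/asboolP; exists k.
move=> /hB xN; apply/hB; apply: submx_trans xN _.
by rewrite -(mxrank_leqif_sup sB) eqn_leq le_r mxrankS.
Qed.

Lemma ker_line (v k : nat) (M : 'M[F]_(v, k)) :
  (exists2 c : 'rV[F]_v, c != 0 & forall x : 'rV_v, x *m M = 0 <-> exists a, x = a *: c) <->
  (\rank M).+1 = v.
Proof.
have rk : \rank (kermx M) = (v - \rank M)%N := mxrank_ker M.
have le_r := rank_leq_row M.
split=> [[c c0 hc]|eq_r].
  have: \rank (kermx M) = 1%N.
    suff /eqmxP -> : (kermx M == c)%MS by rewrite rank_rV c0.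
    apply/andP; split.
      apply/row_subP => i; apply/sub_rVP/hc.
      by rewrite -row_mul mulmx_ker row0.
    by apply/sub_kermxP/hc; exists 1; rewrite scale1r.
  by rewrite rk; lia.
have r1 : \rank (kermx M) = 1%N by rewrite rk; lia.
have /rowV0Pn [c sc c0] : kermx M != 0 by rewrite -mxrank_eq0 r1.
exists c => // x.
have sk : (kermx M <= c)%MS.
  by rewrite -(mxrank_leqif_sup sc) r1 rank_rV c0.
split=> [/sub_kermxP sx|[a ->]]; first by apply/sub_rVP; apply: submx_trans sk.
by rewrite -scalemxAl (sub_kermxP sc) scaler0.
Qed.

(** Minors are taken before applying [rho], so that a rank condition at a point becomes the
    non-vanishing of elements of [A]. *)
Lemma rank_geP_minor (A : comNzRingType) (rho : {rmorphism A -> F}) (u v k : nat)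
    (M : 'M[A]_(u, v)) :
  (k <= \rank (map_mx rho M))%N <->
  exists f g, rho (\det (mxsub f g M : 'M_k)) != 0.
Proof.
split=> [le_k|[f [g]]].
  pose X := map_mx rho M; pose w := widen_ord le_k.
  (* The first k rows of a maximal independent family; k independent columns of that block are then
     chosen through its transpose. *)
  pose f : 'I_k -> 'I_u := maxrankfun X \o w.
  have free : row_free (rowsub f X).
    rewrite /row_free rowsub_comp rowsubE mxrankMfree ?maxrowsub_free //.
    suff -> : rowsub w 1%:M = pid_mx k :> 'M[F]_(k, \rank X) by rewrite rank_pid_mx.
    by apply/matrixP => i j; rewrite !mxE ltn_ord andbT.
  have full : row_full (rowsub f X)^T by rewrite /row_full mxrank_tr.
  exists f, (fullrankfun full); rewrite -det_map_mx map_mxsub -unitfE -unitmxE.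
  have := fullrowsub_unit full; rewrite -unitmx_tr; congr (_ \in unitmx).
  by apply/matrixP => i j; rewrite !mxE.
rewrite -det_map_mx map_mxsub -unitfE -unitmxE => un.
have -> : k = \rank (rowsub f (colsub g (map_mx rho M))).
  by rewrite -[LHS](mxrank_unit un); congr (\rank _); apply/matrixP => i j; rewrite !mxE.
apply: leq_trans (mxrankS (rowsub_sub _ _)) _.
rewrite -mxrank_tr -[X in (_ <= X)%N]mxrank_tr.
suff -> : (colsub g (map_mx rho M))^T = rowsub g (map_mx rho M)^T.
  exact: mxrankS (rowsub_sub _ _).
by apply/matrixP => i j; rewrite !mxE.
Qed.

End LinearAlgebra.

(** * The socle *)

Section TermSum.
Variables (n : nat) (A : comNzRingType) (N : seq 'X_{1..n}).
Hypothesis uN : uniq N.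

Local Notation term := (tnth (in_tuple N)).

Definition term_sum (c : 'rV[A]_(size N)) : {mpoly A[n]} :=
  \sum_i c 0 i *: 'X_[term i].

Lemma mcoeff_term_sum c j : (term_sum c)@_(term j) = c 0 j.
Proof.
have inj : injective term by apply/tuple_uniqP.
rewrite /term_sum raddf_sum /= (bigD1 j) //= mcoeffZ mcoeffX eqxx mulr1.
rewrite big1 ?addr0 // => i neq; rewrite mcoeffZ mcoeffX.
by rewrite (inj_eq inj) (negbTE neq) mulr0.
Qed.

Lemma term_sum_linear a c c' : term_sum (a *: c + c') = a *: term_sum c + term_sum c'.
Proof.
rewrite /term_sum scaler_sumr -big_split; apply: eq_bigr => i _ /=.
by rewrite !mxE scalerA -scalerDl.
Qed.

Lemma supp_in_term_sum c : supp_in (fun m => m \in N) (term_sum c).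
Proof.
apply: supp_in_sum => i _; apply: supp_inZ; apply: (@supp_inX _ _ (fun m => m \in N)).
exact: mem_tnth.
Qed.

Lemma term_sum_mcoeff g : supp_in (fun m => m \in N) g ->
  term_sum (\row_i g@_(term i)) = g.
Proof.
move=> hg; apply/mpolyP => m; have [mN|mN] := boolP (m \in N).
  have /tnthP [i ->] : m \in in_tuple N by [].
  by rewrite mcoeff_term_sum mxE.
rewrite !memN_msupp_eq0 //; apply/negP; first by move/hg; apply/negP.
by move/supp_in_term_sum; apply/negP.
Qed.

End TermSum.

Lemma colon_irrelevantP (F : fieldType) (n : nat) (I : {mpoly F[n]} -> Prop) f :
  is_ideal I -> (colon I (@irrelevant F n) f <-> forall i, I ('X_i * f)).
Proof.
move=> hI; split=> [h i|h g]; first by apply: h; apply: mem_ideal_gen; exists i.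
move=> [s [hs ->]]; rewrite mulr_suml; apply: ideal_sum => // ag /hs [i ->].
by rewrite -mulrA; apply: idealM.
Qed.

Lemma nonterm_list (K : fieldType) (n : nat) (J : {mpoly K[n.+1]} -> Prop) P :
  pommaret_basis J P -> artinian J ->
  exists2 N : seq 'X_{1..n.+1}, uniq N & forall m, m \in N <-> nonterm J m.
Proof.
move=> hP hA; have [D hD] := nonterm_bounded hP hA.
exists [seq m <- [seq bmnm b | b <- enum {: 'X_{1..n.+1 < D}}] | `[< nonterm J m >]].
  by rewrite filter_uniq // map_inj_uniq ?enum_uniq //; apply: val_inj.
move=> m; rewrite mem_filter; split=> [/andP [/asboolP //]|Nm].
apply/andP; split; first exact/asboolP.
by apply/mapP; exists (BMultinom (hD m Nm)); rewrite ?mem_enum.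
Qed.

Section FieldIdeal.
Variables (K : fieldType) (n : nat) (J : {mpoly K[n.+1]} -> Prop).
Variable P : {fset 'X_{1..n.+1}}.
Hypothesis hP : pommaret_basis J P.
Hypothesis hA : artinian J.
Variables (F : fieldType) (h : 'X_{1..n.+1} -> {mpoly F[n.+1]}).
Hypothesis hM : marked_set J P h.
Hypothesis red : reduced J P h.

Local Notation I := (marked_ideal P h).
Let hI : is_ideal I := marked_ideal_ideal P h.

Lemma idealZ (c : F) f : I f -> I (c *: f).
Proof. by rewrite -mul_mpolyC; apply: idealM. Qed.

Lemma nonspan_mod f : exists2 g, nonspan J g & I (f - g).
Proof.
have [q [g r]] := std_rep_exists hP hM f.
by exists g; [case: r | apply: std_rep_mem r].
Qed.

(** The finite set N(J) spans R/I, so a chain of ideals above I is determined by a chain of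
    subspaces of coordinate vectors. *)
Lemma marked_ideal_artinian : artinian I.
Proof.
move=> L idL IL Ldec; have [N uN hN] := nonterm_list hP hA.
have L_scale k c f : L k f -> L k (c *: f) by rewrite -mul_mpolyC; apply: idealM.
have [||| B hB] := @subspace_chain F (size N) (fun k c => L k (term_sum c)).
- move=> k; rewrite /term_sum big1; first by case: (idL k).
  by move=> i _; rewrite mxE scale0r.
- move=> k a x y Lx Ly; rewrite term_sum_linear; apply: idealD => //; exact: L_scale.
- by move=> k x; apply: Ldec.
exists B => k f le_Bk LBf; have [g Ng Ifg] := nonspan_mod f.
have eg : term_sum (\row_i g@_(tnth (in_tuple N) i)) = g.
  by apply: term_sum_mcoeff => // m mg; apply/hN/Ng.
rewrite -(subrK g f); apply: idealD => //; first exact: IL.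
rewrite -eg; apply: hB => //; rewrite eg -[g](subKr f).
by apply: idealB => //; apply: IL.
Qed.

Lemma gorenstein_socle : gorenstein I <->
  exists s, [/\ colon I (@irrelevant F n.+1) s, ~ I s
        & forall f, colon I (@irrelevant F n.+1) f -> exists c : F, I (f - c *: s)].
Proof.
split=> [[]|ex] //; split=> //; first exact: marked_ideal_artinian.
by move=> d f; apply: marked_ideal_homogeneous hM _ _.
Qed.

(** [Phi] induces an isomorphism from the kernel of [M] onto the socle. It serves both for Sigma and
    for multiplication matrices. *)
Lemma gorenstein_ker (v k : nat) (M : 'M[F]_(v, k)) (Phi : 'rV[F]_v -> {mpoly F[n.+1]}) :
  (forall a x y, x *m M = 0 -> y *m M = 0 -> Phi (a *: x + y) = a *: Phi x + Phi y) ->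
  (forall x, x *m M = 0 -> colon I (@irrelevant F n.+1) (Phi x)) ->
  (forall x, x *m M = 0 -> I (Phi x) -> x = 0) ->
  (forall f, colon I (@irrelevant F n.+1) f -> exists2 x, x *m M = 0 & I (f - Phi x)) ->
  gorenstein I <-> (\rank M).+1 = v.
Proof.
move=> Plin Pcol Pinj Psurj.
have Phi0 : Phi 0 = 0.
  have := Plin (-1) 0 0 (mul0mx _ _) (mul0mx _ _).
  by rewrite scaler0 addr0 scaleN1r addNr.
apply: iff_trans gorenstein_socle _; apply: iff_trans (ker_line M).
split=> [[s [cs Is hs]]|[c c0 hc]].
  have [c kc Isc] := Psurj s cs; exists c.
    by apply: contra_notN Is => /eqP c0; move: Isc; rewrite c0 Phi0 subr0.
  move=> x; split=> [kx|[a ->]]; last by rewrite -scalemxAl kc scaler0.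
  have [a Ia] := hs _ (Pcol x kx); exists a; apply/eqP; rewrite -subr_eq0.
  have e : x - a *: c = (- a) *: c + x by rewrite scaleNr addrC.
  rewrite e; apply/eqP; apply: Pinj.
    by rewrite mulmxDl -scalemxAl kc kx scaler0 addr0.
  rewrite Plin //.
  have -> : - a *: Phi c + Phi x = (Phi x - a *: s) + a *: (s - Phi c).
    by rewrite scalerBr addrA subrK scaleNr addrC.
  by apply: idealD => //; apply: idealZ.
have kc : c *m M = 0 by apply/hc; exists 1; rewrite scale1r.
exists (Phi c); split; first exact: Pcol.
  by move/(Pinj c kc)/eqP; apply/negP.
move=> f /Psurj [x /hc [a ->] If]; exists a.
by move: If; rewrite -[a *: c]addr0 Plin ?mul0mx // Phi0 addr0.
Qed.

End FieldIdeal.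

(** * The kernel of Sigma *)

Section StdRepExtra.
Variables (K : fieldType) (n : nat) (J : {mpoly K[n.+1]} -> Prop).
Variable P : {fset 'X_{1..n.+1}}.
Hypothesis hP : pommaret_basis J P.
Variables (A : comNzRingType) (h : 'X_{1..n.+1} -> {mpoly A[n.+1]}).
Hypothesis hM : marked_set J P h.

Local Notation is_std_rep := (@is_std_rep K n J P A h).

Lemma eq_std_rep f q q' g : {in P, q =1 q'} -> is_std_rep f q g -> is_std_rep f q' g.
Proof.
move=> eq_q [ef hq hg]; split=> //.
  rewrite ef big_seq [in RHS]big_seq; congr (_ + _).
  by apply: eq_bigr => a aP; rewrite eq_q.
by move=> a aP m; rewrite -eq_q //; apply: hq.
Qed.

Lemma std_rep_lincomb (r : nat) (x : 'I_r -> A) F Q G :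
  (forall j, is_std_rep (F j) (Q j) (G j)) ->
  is_std_rep (\sum_j x j *: F j) (fun a => \sum_j x j *: Q j a) (\sum_j x j *: G j).
Proof.
move=> hF; split.
- under eq_bigr => j _ do case: (hF j) => -> _ _.
  under eq_bigr => j _ do rewrite scalerDr scaler_sumr.
  rewrite big_split /= exchange_big; congr (_ + _); apply: eq_bigr => a _ /=.
  by rewrite mulr_suml; apply: eq_bigr => j _; rewrite scalerAl.
- move=> a aP; apply: (@supp_in_sum _ _ (mult_term a)) => j _; apply: supp_inZ.
  by case: (hF j) => _ /(_ a aP).
- by apply: supp_in_sum => j _; apply: supp_inZ; case: (hF j).
Qed.

Lemma std_repMx0 f q : is_std_rep f q 0 ->
  is_std_rep ('X_ord0 * f) (fun a => 'X_ord0 * q a) 0.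
Proof. by apply: std_repM => a _; apply/mult_termU. Qed.

Lemma mcoeff0_XM (i : 'I_n.+1) (f : {mpoly A[n.+1]}) : ('X_i * f)@_0%MM = 0.
Proof.
apply/eqP/negbNE/negP => /mcoeffM_neq0 [d [e [+ _ +]]].
rewrite msuppX inE => /eqP -> /(congr1 (fun m : 'X_{1..n.+1} => m i)).
by rewrite mnmDE mnm0E mnm1E eqxx.
Qed.

(* If x_0 x^t is in J while x^t is not, then x_0 x^t lies in the Pommaret
   basis, hence the coefficients are constants. *)
Lemma std_rep_x0 g : nonspan J g -> exists (c : 'X_{1..n.+1} -> A) g',
  is_std_rep ('X_ord0 * g) (fun a => (c a)%:MP) g' /\
  {in P, forall a : 'X_{1..n.+1}, a ord0 = 0%N -> c a = 0}.
Proof.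
move=> Ng; rewrite [g]mpolyE mulr_sumr big_seq; elim/big_ind: _ => [||m mg].
- exists (fun=> 0), 0; split=> //; rewrite mpolyC0.
  by apply: std_rep_nonspan; apply: (@supp_in0 _ _ (nonterm J)).
- move=> f f' [c [g1 [r hc]]] [c' [g2 [r' hc']]].
  exists (fun a => c a + c' a), (g1 + g2); split; last first.
    by move=> a aP a0; rewrite hc ?hc' ?addr0.
  by apply: eq_std_rep (std_repD r r') => a _; rewrite mpolyCD.
rewrite -scalerAr -mpolyXD.
suff [c [g' [r hc]]] : exists (c : 'X_{1..n.+1} -> A) g',
    is_std_rep 'X_[U_(ord0) + m] (fun a => (c a)%:MP) g' /\
    {in P, forall a : 'X_{1..n.+1}, a ord0 = 0%N -> c a = 0}.
  exists (fun a => g@_m * c a), (g@_m *: g'); split; last first.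
    by move=> a aP a0; rewrite hc ?mulr0.
  by apply: eq_std_rep (std_repZ g@_m r) => a _; rewrite mpolyCM mul_mpolyC.
have [/(cone_exists hP) [b [d [bP em mbd]]]|Nm] :=
  pselect (J 'X_[U_(ord0) + m]); last first.
  exists (fun=> 0), 'X_[U_(ord0) + m]; split=> //; rewrite mpolyC0.
  by apply: std_rep_nonspan; apply: (@supp_inX _ _ (nonterm J)).
have em0 : (1 + m ord0 = d ord0 + b ord0)%N.
  by move: (congr1 (fun t : 'X_{1..n.+1} => t ord0) em); rewrite !mnmDE mnm1E eqxx.
(* If x_0 divided x^d, cancelling it would put x^m in J. *)
have d00 : d ord0 = 0%N.
  apply/eqP; apply: contra_notT (Ng m mg) => d0.
  suff -> : m = (d - U_(ord0) + b)%MM by apply: (mem_cone hP).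
  apply: (@addmI _ U_(ord0)%MM); rewrite em addmA [(U_(_) + _)%MM]addmC submK //.
  by rewrite lep1mP.
have b0 : b ord0 != 0%N by move: em0; rewrite d00; lia.
(* As x_0 divides x^b, it is the only variable multiplicative for x^b, so x^d is a power of x_0. *)
have d0 : d = 0%MM.
  apply/mnmP => i; rewrite mnm0E; apply/eqP; apply: contraT => di.
  have : (i <= @ord0 n)%N := mbd i di ord0 b0.
  by rewrite leqn0 => /eqP i0; move: di; rewrite (_ : i = ord0) ?d00 //; apply: val_inj.
rewrite em d0 add0m; exists (fun a => (a == b)%:R), (- (h b - 'X_[b])).
split; last by move=> a _ a0; case: eqP => // eab; move: b0; rewrite -eab a0.
have r1 : is_std_rep (1 * h b) (fun a => if a == b then 1 else 0) 0.
  apply: (@std_rep_head _ _ _ _ _ _ b (fun=> 1)) => //.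
  by rewrite -mpolyX0; apply: supp_inX; apply: mult_term0.
have r2 : is_std_rep (- (h b - 'X_[b])) (fun=> 0) (- (h b - 'X_[b])).
  apply: std_rep_nonspan; apply: (@supp_inN _ _ (nonterm J)).
  exact: (marked_tail hM bP).
have := std_repD r1 r2; rewrite mul1r opprB addrC subrK add0r.
apply: eq_std_rep => a _; rewrite addr0.
by case: (a == b); rewrite ?mpolyC1 ?mpolyC0.
Qed.

End StdRepExtra.

(** Exponent subtraction is truncated and fixes terms free of x_0, so this is division by x_0 only
    on multiples of x_0. *)
Definition div_x0 (n : nat) (A : comNzRingType) (f : {mpoly A[n.+1]}) : {mpoly A[n.+1]} :=
  \sum_(m <- msupp f) f@_m *: 'X_[m - U_(ord0)].

Lemma div_x0K (n : nat) (A : comNzRingType) (f : {mpoly A[n.+1]}) :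
  (forall m : 'X_{1..n.+1}, m ord0 = 0%N -> f@_m = 0) -> 'X_ord0 * div_x0 f = f.
Proof.
move=> hf; rewrite [RHS]mpolyE mulr_sumr big_seq [RHS]big_seq.
apply: eq_bigr => m; rewrite mcoeff_msupp => fm; rewrite -scalerAr -mpolyXD addmC submK //.
by rewrite lep1mP; apply: contraNneq fm => /hf ->.
Qed.

Lemma mpolyX_neq0 (n : nat) (A : comNzRingType) (m : 'X_{1..n}) : 'X_[A, m] != 0.
Proof. by apply/eqP => X0; have := msuppX A m; rewrite X0 msupp0. Qed.

Section SigmaKernel.
Variables (K : fieldType) (n : nat) (J : {mpoly K[n.+1]} -> Prop).
Variable P : {fset 'X_{1..n.+1}}.
Hypothesis hP : pommaret_basis J P.
Hypothesis hA : artinian J.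
Variable h : 'X_{1..n.+1} -> {mpoly K[n.+1]}.
Hypothesis hM : marked_set J P h.
Hypothesis red : reduced J P h.

Local Notation I := (marked_ideal P h).
Local Notation is_std_rep := (@is_std_rep K n J P K h).
Local Notation r := (nheads0 P).
Implicit Types (x : 'rV[K]_r) (a m : 'X_{1..n.+1}).
Let hI : is_ideal I := marked_ideal_ideal P h.

Lemma uniq_heads0 : uniq (heads0 P).
Proof. by rewrite filter_uniq // fset_uniq. Qed.

Lemma mem_heads0 a : (a \in heads0 P) = (a ord0 != 0%N) && (a \in P).
Proof. by rewrite mem_filter. Qed.

Lemma head0P (j : 'I_r) : head0 j \in P /\ head0 j ord0 != 0%N.
Proof.
have := mem_tnth j (in_tuple (heads0 P)).
by rewrite mem_heads0 => /andP [].
Qed.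

Lemma head0_onto a : a \in P -> a ord0 != 0%N -> exists j : 'I_r, a = head0 j.
Proof.
move=> aP a0; have /tnthP [j ->] : a \in in_tuple (heads0 P) by rewrite mem_heads0 a0.
by exists j.
Qed.

Lemma head0_inj : injective (@head0 n P).
Proof. by apply/tuple_uniqP; exact: uniq_heads0. Qed.

Definition head_comb x : {mpoly K[n.+1]} := \sum_j x 0 j *: h (head0 j).

(** Extends [x] by zero to a function on all terms; as [head0] is injective, the sum has at most one
    summand. *)
Definition head_coef x a : K := \sum_(j < r | head0 j == a) x 0 j.

Lemma head_coefE x j : head_coef x (head0 j) = x 0 j.
Proof.
rewrite /head_coef (bigD1 j) //= big1 ?addr0 // => i /andP [/eqP /head0_inj ->].
by rewrite eqxx.
Qed.

Lemma head_combE (c : 'X_{1..n.+1} -> K) :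
  {in P, forall a : 'X_{1..n.+1}, a ord0 = 0%N -> c a = 0} ->
  \sum_(a <- P) (c a)%:MP * h a = head_comb (\row_j c (head0 j)).
Proof.
move=> hc; rewrite (bigID (fun a : 'X_{1..n.+1} => a ord0 != 0%N)) /=.
rewrite [X in _ + X]big_seq_cond [X in _ + X]big1 ?addr0; last first.
  by move=> a /andP [aP /negbNE/eqP a0]; rewrite hc // mpolyC0 mul0r.
rewrite -big_filter -/(heads0 P) /head_comb big_tnth; apply: eq_bigr => j _.
by rewrite mxE mul_mpolyC.
Qed.

(** Constants are allowed as multipliers of every head, so uniqueness lets the entries of [x] be
    compared with the multipliers of any other representation. *)
Lemma head_comb_rep x : is_std_rep (head_comb x) (fun a => (head_coef x a)%:MP) 0.
Proof.
split; last exact: (@supp_in0 _ _ (nonterm J)).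
  rewrite addr0 head_combE; first by congr head_comb; apply/rowP => j; rewrite mxE head_coefE.
  move=> a _ a0; rewrite /head_coef big1 // => j /eqP eja.
  by have [_] := head0P j; rewrite eja a0.
move=> a _ m; rewrite msuppC; case: eqP => // _; rewrite inE => /eqP ->.
exact: mult_term0.
Qed.

Lemma head_comb_mem x : I (head_comb x).
Proof. by rewrite -[head_comb x]subr0; apply: std_rep_mem (head_comb_rep x). Qed.

Lemma head_comb_linear (c : K) x y : head_comb (c *: x + y) = c *: head_comb x + head_comb y.
Proof.
rewrite /head_comb scaler_sumr -big_split; apply: eq_bigr => i _ /=.
by rewrite !mxE scalerA -scalerDl.
Qed.

Lemma mcoeff_x0free_part (f : {mpoly K[n.+1]}) m :
  (x0free_part f)@_m = if m ord0 == 0%N then f@_m else 0.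
Proof.
rewrite /x0free_part raddf_sum /=.
under eq_bigr => i _ do rewrite mcoeffZ mcoeffX.
have [mf|mf] := boolP (m \in msupp f); last first.
  rewrite big1_seq ?(memN_msupp_eq0 mf) ?if_same // => i /andP [_ iF].
  by case: eqP => [eim|_]; rewrite ?mulr0 //; move: mf; rewrite -eim iF.
rewrite big_mkcond (bigD1_seq m) //= eqxx mulr1 big1 ?addr0 // => i /negbTE ne.
by case: ifP => //; rewrite ne mulr0.
Qed.

Lemma Sigma_kerP x : x *m (Sigma_mx J P h)^T = 0 <->
  (forall m : 'X_{1..n.+1}, m ord0 = 0%N -> (head_comb x)@_m = 0) /\
  (forall (k : 'I_n) (i : 'I_r), (\sum_j x 0 j *:
    std_coef J P h ('X_(lift ord0 k) * h (head0 j)) (head0 i))@_0%MM = 0).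
Proof.
have -> : x *m (Sigma_mx J P h)^T = 0 <-> Sigma_mx J P h *m x^T = 0.
  rewrite -[x in x *m _]trmxK -trmx_mul; split=> [/(congr1 trmx)|->].
    by rewrite trmxK trmx0.
  exact: trmx0.
have S1 : Sigma_x0free P h *m x^T = 0 <->
    forall m : 'X_{1..n.+1}, m ord0 = 0%N -> (head_comb x)@_m = 0.
  have E m : (head_comb x)@_m = \sum_j x 0 j * (h (head0 j))@_m.
    by rewrite raddf_sum; apply: eq_bigr => j _; rewrite /= mcoeffZ.
  split=> [/colP S m m0|S]; last first.
    apply/colP => i; rewrite !mxE.
    set m := bmnm (enum_val i); have [m0|m0] := eqVneq (m ord0) 0%N; last first.
      by rewrite big1 // => j _; rewrite !mxE mcoeff_x0free_part (negbTE m0) mul0r.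
    rewrite -[RHS](S m m0) E; apply: eq_bigr => j _.
    by rewrite !mxE mcoeff_x0free_part m0 eqxx mulrC.
  rewrite E; have [lt_m|le_m] := ltnP (mdeg m) (Sigma_bound P h).
    have := S (enum_rank (BMultinom lt_m)); rewrite !mxE => S0.
    rewrite -[RHS]S0; apply: eq_bigr => j _; rewrite !mxE enum_rankK mcoeff_x0free_part /= m0 eqxx.
    exact: mulrC.
  (* A term of degree at least [Sigma_bound] has no row, but it occurs in none of the
     [h (head0 j)]. *)
  rewrite big1 // => j _; rewrite memN_msupp_eq0 ?mulr0 //.
  apply: msize_mdeg_ge; apply: leq_trans le_m.
  exact: (@leq_bigmax_seq _ _ xpredT (fun a => msize (h a)) _ (head0P j).1 isT).
have S2 : \mxcol_(k < n) Sigma_A J P h k *m x^T = 0 <->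
    forall (k : 'I_n) (i : 'I_r), (\sum_j x 0 j *:
      std_coef J P h ('X_(lift ord0 k) * h (head0 j)) (head0 i))@_0%MM = 0.
  have E (k : 'I_n) (i : 'I_r) : (Sigma_A J P h k *m x^T) i 0 = (\sum_j x 0 j *:
      std_coef J P h ('X_(lift ord0 k) * h (head0 j)) (head0 i))@_0%MM.
    rewrite mxE raddf_sum; apply: eq_bigr => j _.
    by rewrite /= mcoeffZ !mxE mulrC.
  rewrite mxcol_mul; split=> [S k i|S]; last first.
    rewrite -[RHS](mxcol0 (p_ := fun=> r)); apply: eq_mxcol => k.
    by apply/colP => i; rewrite E S mxE.
  rewrite -E; move: S; rewrite -[X in _ = X](mxcol0 (p_ := fun=> r)) => /eq_mxcolP /(_ k) ->.
  by rewrite mxE.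
rewrite /Sigma_mx mul_col_mx; split=> [S|[/S1 -> /S2 ->]]; last exact: col_mx0.
by move: S; rewrite -col_mx0 => /eq_col_mx [/S1 ? /S2 ?].
Qed.

(** With s the quotient by x_0 and g the remainder of f = x_k s, represent x_0 f in two ways: by
    combining the representations of the x_k h_j, and as x_0 (f - g) + x_0 g. Sigma kills the
    constant terms of the former at heads divisible by x_0; in the latter they are the coefficients
    of x_0 g. *)
Lemma Sigma_socle x : x *m (Sigma_mx J P h)^T = 0 ->
  colon I (@irrelevant K n.+1) (div_x0 (head_comb x)).
Proof.
move=> /Sigma_kerP [/div_x0K es S2]; move: es; set s := div_x0 _ => es.
apply/colon_irrelevantP => // i; case: (unliftP ord0 i) => [k ->|->]; last first.
  by rewrite es; apply: head_comb_mem.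
set f := 'X_(lift ord0 k) * s.
have ef : 'X_ord0 * f = \sum_j x 0 j *: ('X_(lift ord0 k) * h (head0 j)).
  rewrite /f mulrCA es mulr_sumr; by apply: eq_bigr => j _; rewrite scalerAr.
have If : I ('X_ord0 * f) by rewrite /f mulrCA es; apply: idealM => //; apply: head_comb_mem.
have rQ := std_rep_lincomb (x 0) (fun j => std_repP hP hM ('X_(lift ord0 k) * h (head0 j))).
rewrite -ef in rQ.
have [q [g rf]] := std_rep_exists hP hM f; have [_ _ Ng] := rf.
have [c [g' [rg hc]]] := std_rep_x0 hP hM Ng.
have rf0 : is_std_rep (f - g) q 0.
  have := std_repB rf (std_rep_nonspan P h Ng); rewrite subrr.
  by apply: eq_std_rep => a _; rewrite subr0.
have rX := std_repD (std_repMx0 rf0) rg.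
rewrite mulrBr subrK add0r in rX.
have [eq_q _] := std_rep_unique hP hM rQ rX.
have c0 : {in P, forall a, c a = 0}.
  move=> a aP; have [/hc -> //|a0] := eqVneq (a ord0) 0%N.
  have [j ea] := head0_onto aP a0.
  have := congr1 (mcoeff 0%MM) (eq_q a aP).
  by rewrite ea S2 mcoeffD mcoeff0_XM add0r mcoeffC eqxx mulr1 => <-.
(* With its coefficients [c] zero, x_0 g equals its remainder [g'], which is also the remainder of
   x_0 f, an element of I. *)
have g'0 : g' = 0 := reduced_rem red If rX.
have g0 : 'X_ord0 * g = 0.
  case: rg => -> _ _; rewrite g'0 addr0 big_seq big1 // => a aP.
  by rewrite c0 // mpolyC0 mul0r.
have -> : f = f - 0 by rewrite subr0.
suff <- : g = 0 by apply: std_rep_mem rf.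
by apply: (mulfI (mpolyX_neq0 K U_(ord0))); rewrite mulr0.
Qed.

(** If s is in I, then x_0 s has a representation with all multipliers divisible by x_0; by
    uniqueness they are the constants given by [x], hence 0. *)
Lemma Sigma_socle_inj x : x *m (Sigma_mx J P h)^T = 0 ->
  I (div_x0 (head_comb x)) -> x = 0.
Proof.
move=> /Sigma_kerP [/div_x0K es _]; move: es; set s := div_x0 _ => es Is.
have [q [g rs]] := std_rep_exists hP hM s.
have g0 := reduced_rem red Is rs; rewrite g0 in rs.
have rX := std_repMx0 rs; rewrite es in rX.
have [eq_q _] := std_rep_unique hP hM (head_comb_rep x) rX.
apply/rowP => j; rewrite mxE -head_coefE.
have := congr1 (mcoeff 0%MM) (eq_q _ (head0P j).1).
by rewrite mcoeff0_XM mcoeffC eqxx mulr1.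
Qed.

(** The solution collects the constant multipliers of x_0 g, with g the remainder of f. Since x_k g
    is in I, the multipliers of x_0 x_k g are divisible by x_0, which gives the equations of A_k. *)
Lemma Sigma_socle_surj f : colon I (@irrelevant K n.+1) f ->
  exists2 x, x *m (Sigma_mx J P h)^T = 0 & I (f - div_x0 (head_comb x)).
Proof.
move=> cf; have [g Ng Ifg] := nonspan_mod hP hM f.
have Ig i : I ('X_i * g).
  rewrite -[g](subKr f) mulrBr; apply: idealB => //; last exact: idealM.
  by move: i; apply/colon_irrelevantP.
have [c [g' [rg hc]]] := std_rep_x0 hP hM Ng.
have g'0 := reduced_rem red (Ig ord0) rg; rewrite g'0 in rg.
have eg : head_comb (\row_j c (head0 j)) = 'X_ord0 * g.
  by rewrite -head_combE //; case: rg => -> _ _; rewrite addr0.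
have x0free m : m ord0 = 0%N -> (head_comb (\row_j c (head0 j)))@_m = 0.
  move=> m0; rewrite eg; apply/eqP/negbNE/negP => /mcoeffM_neq0 [d [e [+ _ em]]].
  by rewrite msuppX inE => /eqP ed; move: m0; rewrite em ed mnmDE mnm1E eqxx.
exists (\row_j c (head0 j)).
  apply/Sigma_kerP; split=> // k i.
  have [q [g1 rk]] := std_rep_exists hP hM ('X_(lift ord0 k) * g).
  have g10 := reduced_rem red (Ig _) rk; rewrite g10 in rk.
  have rX := std_repMx0 rk; rewrite mulrCA -eg in rX.
  have rQ := std_rep_lincomb ((\row_j c (head0 j)) 0)
    (fun j : 'I_r => std_repP hP hM ('X_(lift ord0 k) * h (head0 j))).
  have eF : \sum_(j < r) (\row_j c (head0 j)) 0 j *: ('X_(lift ord0 k) * h (head0 j)) =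
      'X_(lift ord0 k) * head_comb (\row_j c (head0 j)).
    rewrite /head_comb mulr_sumr; by apply: eq_bigr => j _; rewrite -scalerAr.
  rewrite eF in rQ.
  have [eq_q _] := std_rep_unique hP hM rQ rX; rewrite (eq_q _ (head0P i).1).
  exact: mcoeff0_XM.
suff -> : div_x0 (head_comb (\row_j c (head0 j))) = g by [].
by apply: (mulfI (mpolyX_neq0 K U_(ord0))); rewrite div_x0K.
Qed.

Lemma gorenstein_Sigma : gorenstein I <-> (\rank (Sigma_mx J P h)).+1 = r.
Proof.
rewrite -mxrank_tr; apply: (gorenstein_ker hP hA hM (Phi := fun x => div_x0 (head_comb x))).
- move=> a x y /Sigma_kerP [x0x _] /Sigma_kerP [x0y _].
  (* On multiples of x_0, linearity of [div_x0] can be checked after multiplying by x_0. *)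
  apply: (mulfI (mpolyX_neq0 K U_(ord0))).
  rewrite mulrDr -scalerAr !div_x0K ?head_comb_linear // => m m0.
  by rewrite mcoeffD mcoeffZ x0x ?x0y // mulr0 addr0.
- exact: Sigma_socle.
- exact: Sigma_socle_inj.
- exact: Sigma_socle_surj.
Qed.

End SigmaKernel.

(** * Multiplication matrices *)

Section MultiplicationMatrix.
Variables (n : nat) (A : comNzRingType) (N : seq 'X_{1..n.+1}).

Local Notation term := (tnth (in_tuple N)).

(* When G k i is x_k x^{N_i} reduced to a combination of the terms in N, the
   rows are the coordinates of (x_0 x^{N_i}, ..., x_n x^{N_i}) on these terms. *)
Definition mult_mx (G : 'I_n.+1 -> 'I_(size N) -> {mpoly A[n.+1]}) :
    'M[A]_(size N, #|{: 'I_n.+1 * 'I_(size N)}|) :=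
  \matrix_(i, j) (G (enum_val j).1 i)@_(term (enum_val j).2).

Lemma mult_mx_ker G (c : 'rV[A]_(size N)) :
  (forall k i, supp_in (fun m => m \in N) (G k i)) ->
  c *m mult_mx G = 0 <-> forall k, \sum_i c 0 i *: G k i = 0.
Proof.
move=> hG.
have E j : (c *m mult_mx G) 0 j =
    (\sum_i c 0 i *: G (enum_val j).1 i)@_(term (enum_val j).2).
  rewrite mxE raddf_sum; apply: eq_bigr => i _; by rewrite /= mcoeffZ mxE.
split=> [M0 k|S]; last by apply/rowP => j; rewrite E S mcoeff0 mxE.
apply/mpolyP => m; rewrite mcoeff0; have [mN|mN] := boolP (m \in N).
  have /tnthP [l ->] : m \in in_tuple N by [].
  by have := E (enum_rank (k, l)); rewrite M0 mxE enum_rankK.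
apply: memN_msupp_eq0; apply: contra mN; move: m.
by apply: supp_in_sum => i _; apply: supp_inZ.
Qed.

End MultiplicationMatrix.

Section GorensteinMult.
Variables (K : fieldType) (n : nat) (J : {mpoly K[n.+1]} -> Prop).
Variable P : {fset 'X_{1..n.+1}}.
Hypothesis hP : pommaret_basis J P.
Hypothesis hA : artinian J.
Variables (F : fieldType) (h : 'X_{1..n.+1} -> {mpoly F[n.+1]}).
Hypothesis hM : marked_set J P h.
Hypothesis red : reduced J P h.
Variable N : seq 'X_{1..n.+1}.
Hypothesis uN : uniq N.
Hypothesis hN : forall m, m \in N <-> nonterm J m.
Variable G : 'I_n.+1 -> 'I_(size N) -> {mpoly F[n.+1]}.
Hypothesis GN : forall k i, nonspan J (G k i).

Local Notation I := (marked_ideal P h).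
Local Notation term := (tnth (in_tuple N)).
Hypothesis GI : forall k i, I ('X_k * 'X_[term i] - G k i).
Let hI : is_ideal I := marked_ideal_ideal P h.

Let GsuppN k i : supp_in (fun m => m \in N) (G k i).
Proof. by move=> m /GN /hN. Qed.

Lemma nonspan_term_sum (c : 'rV[F]_(size N)) : nonspan J (term_sum c).
Proof. by move=> m /supp_in_term_sum /hN. Qed.

(** Modulo I the product is the combination of the [G k i], which lies in the span of N(J) and so
    belongs to I only when it is 0. *)
Lemma mem_mult_term_sum (c : 'rV[F]_(size N)) k :
  I ('X_k * term_sum c) <-> \sum_i c 0 i *: G k i = 0.
Proof.
have Id : I ('X_k * term_sum c - \sum_i c 0 i *: G k i).
  rewrite /term_sum mulr_sumr -sumrB; apply: ideal_sum => // i _.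
  by rewrite -scalerAr -scalerBr; apply: idealZ.
split=> [Ix|S0]; last by rewrite -(subr0 ('X_k * _)) -S0.
apply: red.
  by rewrite -[X in I X](subKr ('X_k * term_sum c)); apply: idealB.
apply: (@supp_in_sum _ _ (nonterm J)) => i _; apply: supp_inZ; exact: GN.
Qed.

(** Each class of R/I has exactly one representative in the span of N(J), so [term_sum] identifies
    the kernel with the socle. *)
Lemma gorenstein_mult_mx : gorenstein I <-> (\rank (mult_mx G)).+1 = size N.
Proof.
have kerP c : c *m mult_mx G = 0 <-> colon I (@irrelevant F n.+1) (term_sum c).
  apply: iff_trans (mult_mx_ker c GsuppN) _.
  split=> [S|/(colon_irrelevantP _ hI) S k]; last by apply/mem_mult_term_sum/S.
  by apply/(colon_irrelevantP _ hI) => k; apply/mem_mult_term_sum/S.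
apply: (gorenstein_ker hP hA hM (Phi := @term_sum _ _ N)).
- by move=> a x y _ _; apply: term_sum_linear.
- by move=> x /kerP.
- move=> x _ /red /(_ (@nonspan_term_sum x)) x0; apply/rowP => j.
  by rewrite -(mcoeff_term_sum uN) x0 mcoeff0 mxE.
- move=> f cf; have [g Ng Ifg] := nonspan_mod hP hM f.
  have eg : term_sum (\row_i g@_(term i)) = g.
    by apply: term_sum_mcoeff => // m /Ng /hN.
  exists (\row_i g@_(term i)); rewrite ?eg //; apply/kerP; rewrite eg.
  apply/(colon_irrelevantP _ hI) => k; rewrite -[g](subKr f) mulrBr.
  apply: idealB => //; last exact: idealM.
  by move: k; apply/(colon_irrelevantP _ hI).
Qed.

(* A term of maximal degree in N(J) lies in the socle. *)
Lemma mult_mx_rank_lt : (0 < size N)%N -> (\rank (mult_mx G) < size N)%N.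
Proof.
move=> N0.
case: (@arg_maxnP _ (Ordinal N0) xpredT (fun i => mdeg (term i)) isT) => i _ maxi.
have ker_i : (delta_mx 0 i : 'rV_(size N)) *m mult_mx G = 0.
  apply: (proj2 (mult_mx_ker _ GsuppN)) => k.
  apply/mem_mult_term_sum.
  have -> : term_sum (delta_mx 0 i) = 'X_[term i] :> {mpoly F[n.+1]}.
    rewrite /term_sum (bigD1 i) //= big1 ?addr0 ?mxE ?eqxx ?scale1r // => j /negbTE ne.
    by rewrite mxE ne andbF scale0r.
  (* In degree one above the maximum, N(J) has no terms: this component of [G k i] vanishes, leaving
     x_k times the chosen term in I. *)
  have := marked_ideal_homogeneous hM (mdeg (term i)).+1 (GI k i).
  rewrite pihomogB -mpolyXD pihomogX /= mdegD mdeg1 eqxx mpolyXD.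
  suff -> : pihomog mdeg (mdeg (term i)).+1 (G k i) = 0 by rewrite subr0.
  rewrite pihomogE big1_seq // => m /andP [/eqP dm mG].
  have /tnthP [l em] : m \in in_tuple N by apply: (GsuppN mG).
  by have := maxi l isT; rewrite /= -em dm ltnn.
rewrite ltn_neqAle rank_leq_row andbT; apply/negP => free.
have /(row_free_inj free) : (delta_mx 0 i : 'rV_(size N)) *m mult_mx G = 0 *m mult_mx G.
  by rewrite ker_i mul0mx.
by move/rowP/(_ i)/eqP; rewrite !mxE !eqxx oner_eq0.
Qed.

(** The upper bound on the rank turns the equality into an inequality, which is an open condition.
    Positivity of [size N] excludes the unit ideal, where the predecessor is truncated to 0. *)
Lemma gorenstein_mult_rank :
  gorenstein I <-> (0 < size N)%N /\ ((size N).-1 <= \rank (mult_mx G))%N.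
Proof.
apply: iff_trans gorenstein_mult_mx _; split=> [eN|[N0 le]]; first by split; lia.
by have := mult_mx_rank_lt N0; lia.
Qed.

End GorensteinMult.

(** * The residue map at a prime as a ring morphism *)

Section Residue.
Variables (A : comNzRingType) (p : prime_idealr A).

Lemma residue_is_zmod_morphism : zmod_morphism (@residue A p).
Proof.
move=> a b; rewrite /residue raddfB.
exact: (raddfB (@FracField.tofrac (quot_dom p))).
Qed.

Lemma residue_is_monoid_morphism : monoid_morphism (@residue A p).
Proof.
split=> [|a b].
  by rewrite /residue rmorph1; apply: (rmorph1 (@FracField.tofrac (quot_dom p))).
by rewrite /residue rmorphM; apply: (rmorphM (@FracField.tofrac (quot_dom p))).
Qed.

HB.instance Definition _ :=
  GRing.isZmodMorphism.Build A (residue_field p) (@residue A p) residue_is_zmod_morphism.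
HB.instance Definition _ :=
  GRing.isMonoidMorphism.Build A (residue_field p) (@residue A p) residue_is_monoid_morphism.

Lemma residue_eq0 a : (residue p a == 0) = (a \in p).
Proof.
rewrite /residue (tofrac_eq0 (R := quot_dom p)).
by rewrite -[in RHS](subr0 a) Quotient.idealrBE rmorph0.
Qed.

End Residue.

(** * The marked scheme *)

Section MarkedMap.
Variables (K : fieldType) (n : nat) (J : {mpoly K[n.+1]} -> Prop).
Variable P : {fset 'X_{1..n.+1}}.
Hypothesis hP : pommaret_basis J P.

(** The condition is put on tails because their supports can only shrink under a base change. *)
Lemma marked_setP (A : comNzRingType) (h : 'X_{1..n.+1} -> {mpoly A[n.+1]}) :
  (forall a, a \in P ->
    supp_in (fun m => nonterm J m /\ mdeg m = mdeg a) (h a - 'X_[a])) ->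
  marked_set J P h.
Proof.
move=> hT a aP; have eh : h a = 'X_[a] + (h a - 'X_[a]) by rewrite addrC subrK.
split=> [||m].
- rewrite eh; apply: rpredD; first by rewrite dhomogX.
  by apply/dhomogP => m /(hT a aP) [].
- rewrite eh mcoeffD mcoeffX eqxx memN_msupp_eq0 ?addr0 //.
  by apply/negP => /(hT a aP) [+ _]; apply; rewrite -[a]add0m; apply: (mem_cone hP).
- rewrite mcoeff_msupp => ma ne; suff : m \in msupp (h a - 'X_[a]) by case/(hT a aP).
  by rewrite mcoeff_msupp mcoeffB mcoeffX [a == m]eq_sym (negbTE ne) subr0.
Qed.

Variables (A B : comNzRingType) (rho : {rmorphism A -> B}).
Variable h : 'X_{1..n.+1} -> {mpoly A[n.+1]}.
Hypothesis hM : marked_set J P h.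

Lemma supp_in_map (Q : 'X_{1..n.+1} -> Prop) (f : {mpoly A[n.+1]}) :
  supp_in Q f -> supp_in Q (map_mpoly rho f).
Proof.
move=> /supp_inP hf; apply/supp_inP => m /hf fm.
by rewrite mcoeff_map_mpoly fm raddf0.
Qed.

Lemma marked_set_map : marked_set J P (fun a => map_mpoly rho (h a)).
Proof.
apply: marked_setP => a aP; rewrite -(map_mpolyX rho) -raddfB; apply: supp_in_map => m mt.
by split; [apply: (marked_tail hM aP) | apply: (marked_tail_deg hM aP)].
Qed.

Lemma std_rep_map f q g : is_std_rep J P h f q g ->
  is_std_rep J P (fun a => map_mpoly rho (h a))
    (map_mpoly rho f) (fun a => map_mpoly rho (q a)) (map_mpoly rho g).
Proof.
move=> [-> hq hg]; split.
- rewrite raddfD raddf_sum; congr (_ + _).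
  by apply: eq_bigr => a _; rewrite /= rmorphM.
- by move=> a aP; apply: supp_in_map; apply: hq.
- exact: supp_in_map.
Qed.

End MarkedMap.

Section Universal.
Variables (K : fieldType) (n : nat) (J : {mpoly K[n.+1]} -> Prop).
Variable P : {fset 'X_{1..n.+1}}.
Hypothesis hP : pommaret_basis J P.

Local Notation hU := (@univ_marked K n J P).

Lemma univ_marked_set : marked_set J P hU.
Proof.
apply: (marked_setP hP) => a aP; rewrite /univ_marked addrAC subrr add0r.
apply: supp_inN; rewrite -big_filter; apply: supp_in_sum => i.
rewrite mem_filter => /andP [/eqP ei _]; apply: supp_inZ.
apply: (@supp_inX _ _ (fun m => nonterm J m /\ mdeg m = mdeg a)).
move: ei (mem_tnth i (in_tuple (Cindex J P))).
case: (tnth _ _) => b e /= -> /allpairsPdep [c [d [_ + [ec ->]]]].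
by rewrite mem_filter -ec => /andP [/asboolP Nd]; rewrite mem_filter => /andP [/eqP].
Qed.

Variable p : prime_idealr (KC J P).

Local Notation hp := (fun a => map_mpoly (@residue _ p) (hU a)).

(** The remainders of the non-multiplicative products have their coefficients in U, so they vanish
    in the residue field and [criterion_reduced] applies. *)
Lemma point_reduced : Mf J P p -> reduced J P hp.
Proof.
move=> Up; apply: (criterion_reduced hP) => [|a i aP nmult].
  exact: marked_set_map univ_marked_set.
have := std_rep_map (@residue _ p) (std_repP hP univ_marked_set ('X_i * hU a)).
rewrite rmorphM /= map_mpolyX.
suff -> : map_mpoly (@residue _ p) (std_rem J P hU ('X_i * hU a)) = 0.
  by move=> r; eexists; apply: r.
apply/mpolyP => m; rewrite mcoeff_map_mpoly mcoeff0; apply/eqP; rewrite residue_eq0.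
by apply: Up; apply: mem_ideal_gen; exists a, i, m.
Qed.

End Universal.

Theorem corollary5p3 (K : fieldType) (n : nat)
    (J : {mpoly K[n.+1]} -> Prop) (P : {fset 'X_{1..n.+1}})
    (hJ : monomial_ideal J) (hA : artinian J) (hP : pommaret_basis J P) :
  (forall h : 'X_{1..n.+1} -> {mpoly K[n.+1]}, marked_basis J P h ->
     (gorenstein (marked_ideal P h) <->
        (\rank (Sigma_mx J P h)).+1 = nheads0 P)) /\
  zariski_open_in (Mf J P) (gorenstein_locus J P).
Proof.
split=> [h hB|].
  have [hM _] := hB; apply: (gorenstein_Sigma hP hA hM).
  exact: (marked_basis_reduced hM hB).
have [N uN hN] := nonterm_list hP hA.
pose hU := @univ_marked K n J P; have hM := univ_marked_set hP.
pose G k i := std_rem J P hU ('X_k * 'X_[tnth (in_tuple N) i]).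
(* The minors of size |N(J)| - 1 over K[C]. When N(J) is empty [E] is empty too, and so is the open
   set it defines. *)
pose E (f : KC J P) := (0 < size N)%N /\
  exists u w, f = \det (mxsub u w (mult_mx G) : 'M_((size N).-1)).
exists (fun p => ~ zariski_closed_of E p); first by exists E.
move=> p; rewrite /gorenstein_locus.
suff key : Mf J P p -> gorenstein (@point_ideal K n J P p) <-> ~ zariski_closed_of E p.
  by split=> -[Up /(key Up)].
move=> Up; pose rho : {rmorphism KC J P -> residue_field p} := @residue _ p.
pose Gp k i := map_mpoly rho (G k i).
have hMp : marked_set J P (fun a => map_mpoly rho (hU a)) := marked_set_map hP rho hM.
have red : reduced J P (fun a => map_mpoly rho (hU a)) := point_reduced hP Up.
(* Reductions over K[C] specialize to reductions at [p], so one universal matrix serves for all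
   points. *)
have rG k i := std_rep_map rho (std_repP hP hM ('X_k * 'X_[tnth (in_tuple N) i])).
have GN k i : nonspan J (Gp k i) by case: (rG k i).
have GI k i : marked_ideal P (fun a => map_mpoly rho (hU a))
    ('X_k * 'X_[tnth (in_tuple N) i] - Gp k i).
  by have := std_rep_mem (rG k i); rewrite rmorphM /= !map_mpolyX.
apply: iff_trans (gorenstein_mult_rank hP hA hMp red uN hN GN GI) _.
have -> : mult_mx Gp = map_mx rho (mult_mx G).
  by apply/matrixP => i j; rewrite !mxE mcoeff_map_mpoly.
split=> [[N0 /rank_geP_minor [u [w det0]]] cl|ncl].
  move: det0; rewrite residue_eq0 => /negP; apply; apply: cl.
  by split=> //; exists u, w.
have [f [N0 [u [w ->]]] det0] : exists2 f, E f & f \notin p.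
  apply: contrapT => nex; apply: ncl => f Ef; apply: contrapT => fp.
  by apply: nex; exists f => //; apply/negP.
by split=> //; apply/rank_geP_minor; exists u, w; rewrite residue_eq0.
Qed.
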